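(* Let $K$ be a convex body in $\mathbb{R}^d$. Let $C_1,\dots,C_N$ be cylinders in $\mathbb{R}^d$ such that $$K\subset \bigcup_{i=1}^N C_i .$$ Then $$\sum_{i=1}^N \mathrm{crv}_K(C_i)\ \ge\ \frac{1}{d}.$$ Moreover, if $K$ is an ellipsoid, then $$\sum_{i=1}^N \mathrm{crv}_K(C_i)\ \ge\ 1.$$
   Context: A convex body in $\mathbb{R}^d$ is a compact convex set with non-empty interior. A cylinder in $\mathbb{R}^d$ (meaning a 1-codimensional cylinder) is a set $C\subset\mathbb{R}^d$ that can be written as $C=\ell+B$, where $\ell$ is a line through the origin $0$ in $\mathbb{R}^d$ and $B$ is a measurable subset of the $(d-1)$-dimensional linear subspace $E:=\ell^{\perp}$ (orthogonal complement with respect to the canonical inner product). For a linear subspace $E$, $P_E$ denotes the orthogonal projection onto $E$, and $\mathrm{vol}_n$ denotes $n$-dimensional volume. For a convex body $K$ and a cylinder $C=\ell+B$ with $E=\ell^\perp$, the cross-sectional volume of $C$ with respect to $K$ is $$\mathrm{crv}_K(C):=\frac{\mathrm{vol}_{d-1}(C\cap E)}{\mathrm{vol}_{d-1}(P_E K)}=\frac{\mathrm{vol}_{d-1}(B)}{\mathrm{vol}_{d-1}(P_E K)}.$$ *)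

(* Defs.v *)
From HB Require Import structures.
From mathcomp Require Import all_boot all_order all_algebra.
From mathcomp Require Import all_classical all_reals all_analysis.

Set Implicit Arguments.
Unset Strict Implicit.
Unset Printing Implicit Defensive.

Import Order.TTheory GRing.Theory Num.Theory.
Import numFieldNormedType.Exports.

Local Open Scope classical_set_scope.
Local Open Scope ring_scope.

(* n-fold product of the one-dimensional Lebesgue measure on Borel sets; on the
   one-point space R^0 it is the unit point mass. *)
Fixpoint lebesgue_tuple (R : realType) (n : nat) : set (n.-tuple R) -> \bar R :=
  match n with
  | 0 => dirac [tuple]
  | k.+1 => pushforward (lebesgue_measure \x @lebesgue_tuple R k)%E
              (fun p : R * k.-tuple R => [tuple of p.1 :: p.2])
  end.

(* vol_n is the outer measure generated by the product measure, so that
   Caratheodory measurability is Lebesgue measurability (not only Borel). *)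
Definition vol (R : realType) (n : nat) (A : set 'rV[R]_n) : \bar R :=
  ((@lebesgue_tuple R n)^*)%mu [set t | A (\row_i tnth t i)].

Definition lebesgue_measurable (R : realType) (n : nat) (A : set 'rV[R]_n) :=
  caratheodory_measurable (@vol R n) A.

(* A linear subspace of R^d is given by (the row space of) a matrix. *)
Definition subspace (R : realType) (m d : nat) (U : 'M[R]_(m, d)) :
  set 'rV[R]_d := [set x | (x <= U)%MS].

Definition orthogonal (R : realType) (m d : nat) (U : 'M[R]_(m, d)) : 'M[R]_d :=
  orthomx idfun 1%:M U.

Definition orthogonal_projection (R : realType) (d : nat) (E : 'M[R]_d)
  (x : 'rV[R]_d) : 'rV[R]_d := x *m proj_mx E (orthogonal E).

Definition orthonormal_basis (R : realType) (k d : nat) (E : 'M[R]_d)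
  (Q : 'M[R]_(k, d)) := Q *m Q^T = 1%:M /\ (Q == E)%MS.

(* An arbitrary orthonormal basis, as the rows of a matrix. The default value
   row_base E is never used since every subspace has such a basis, and vol_on
   below does not depend on the choice since vol is rotation invariant. *)
Definition onb (R : realType) (d : nat) (E : 'M[R]_d) : 'M[R]_(\rank E, d) :=
  xget (row_base E) [set Q | orthonormal_basis E Q].

Definition coordinates (R : realType) (d : nat) (E : 'M[R]_d)
  (A : set 'rV[R]_d) : set 'rV[R]_(\rank E) := [set x | A (x *m onb E)].
Arguments coordinates {R d} E A.

(* (\rank E)-dimensional volume of A, for A included in E *)
Definition vol_on (R : realType) (d : nat) (E : 'M[R]_d) (A : set 'rV[R]_d) :
  \bar R := vol (coordinates E A).

Definition measurable_on (R : realType) (d : nat) (E : 'M[R]_d)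
  (A : set 'rV[R]_d) :=
  A `<=` subspace E /\ lebesgue_measurable (coordinates E A).

Definition convex_body (R : realType) (d : nat) (K : set 'rV[R]_d) :=
  [/\ compact K, convex_set K & interior K !=set0].

(* The norm of 'rV[R]_d in the library is the sup norm, hence the explicit
   Euclidean ball. *)
Definition euclidean_unit_ball (R : realType) (d : nat) : set 'rV[R]_d :=
  [set x | \sum_(i < d) x ord0 i ^+ 2 <= 1].

Definition ellipsoid (R : realType) (d : nat) (K : set 'rV[R]_d) :=
  exists (A : 'M[R]_d) (c : 'rV[R]_d), A \in unitmx /\
    K = [set c + x *m A | x in @euclidean_unit_ball R d].

(* The cylinder line + base, where the line is spanned by the vector axis. *)
Record cylinder (R : realType) (d : nat) := Cylinder {
  axis : 'rV[R]_d ;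
  base : set 'rV[R]_d ;
  axis_neq0 : axis != 0 ;
  base_measurable : measurable_on (orthogonal axis) base }.

Definition cylinder_set (R : realType) (d : nat) (C : cylinder R d) :
  set 'rV[R]_d := [set x + y | x in subspace (axis C) & y in base C].

Definition cross_space (R : realType) (d : nat) (C : cylinder R d) : 'M[R]_d :=
  orthogonal (axis C).

Definition crv (R : realType) (d : nat) (K : set 'rV[R]_d) (C : cylinder R d) :
  \bar R :=
  let E := cross_space C in
  (vol_on E (cylinder_set C `&` subspace E) /
   vol_on E (orthogonal_projection E @` K))%E.

(* Main.v *)
From HB Require Import structures.
Require Import Defs.
From mathcomp Require Import all_boot all_order all_algebra.
From mathcomp Require Import all_classical all_reals all_analysis.
From mathcomp Require Import measurable_realfun unstable lra ring.

Set Implicit Arguments.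
Unset Strict Implicit.
Unset Printing Implicit Defensive.

Import Order.TTheory GRing.Theory Num.Theory.
Import numFieldNormedType.Exports.

Local Open Scope classical_set_scope.
Local Open Scope ring_scope.

(** Weigh the body K by a function f >= 0 that vanishes outside K and has a
    finite positive integral. Let C be a cylinder with axis a, and let E be the
    hyperplane orthogonal to a. By Fubini along a, the f-mass of C is the
    integral, over the cross-section of C in E, of the chord integrals of f in
    the direction a. If each chord integral is at most D times the mean of f
    over the projection P_E K, that is D * (int f) / vol (P_E K), then the
    f-mass of C is at most D * crv_K(C) * int f ([crv_bound]). The cylinders
    cover K, so adding up gives D * sum_i crv_K(C_i) >= 1 ([covering_bound]).
    It remains to find a good weight.

    - For a convex body take f = 1 on K. The chord integral is the length of a
      chord, and the bound with D = d is the inequality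
      (length of a chord) * vol (P_E K) <= d * vol K ([chord_shadow_le]). The
      convex hull of the chord over y0 and of a point of K over y has, over
      (1 - s) y0 + s y, a chord of length (1 - s) times the one over y0. Hence
      the chords which are at least that long fill a copy of P_E K shrunk by s,
      and integrating s^(d-1) over [0, 1] produces the factor 1/d.

    - For an ellipsoid q <= 1, with q a quadratic polynomial, take
      f = (1 - q)^(-1/2). On a line q is a parabola, and an affine change of
      variable shows that the integral of f over the line depends only on its
      direction as soon as the line meets the open ellipsoid: it is a multiple
      of the integral of (1 - t^2)^(-1/2) over [-1, 1]
      ([integral_density_axis]). All chord integrals in the direction a being
      equal, the bound holds with D = 1.

    Fubini along an arbitrary direction needs a linear change of coordinates.
    Its Jacobian cancels, because each estimate compares two integrals in the
    same coordinates; so it suffices that an invertible linear map multiplies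
    Lebesgue measure by some positive constant ([leb_linear]), which is the
    uniqueness of translation-invariant measures. Outer volumes are reduced to
    measures by measurable hulls ([vol_hull]). *)

Local Notation orthogonal := Defs.orthogonal.

(** * Row vectors as a measurable space *)

(** * Row vectors as a measurable space *)

Lemma measurable_preimage d1 d2 (T1 : measurableType d1)
  (T2 : measurableType d2)
    (f : T1 -> T2) (A : set T2) :
  measurable_fun setT f -> measurable A -> measurable (f @^-1` A).
Proof. by move=> mf mA; rewrite -[_ @^-1` _]setTI; exact: mf. Qed.

Section row_measurable.
Context (R : realType) (n : nat).

Definition row_of_tuple (t : n.-tuple R) : 'rV[R]_n := \row_i tnth t i.

Definition tuple_of_row (x : 'rV[R]_n) : n.-tuple R := [tuple x ord0 i | i < n].

Lemma row_of_tupleK : cancel row_of_tuple tuple_of_row.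
Proof. by move=> t; apply: eq_from_tnth => i; rewrite tnth_mktuple mxE. Qed.

Lemma tuple_of_rowK : cancel tuple_of_row row_of_tuple.
Proof. by move=> x; apply/rowP => i; rewrite mxE tnth_mktuple. Qed.

Definition row_measurable : set (set 'rV[R]_n) :=
  [set A | measurable (row_of_tuple @^-1` A)].

Let row_measurable0 : row_measurable set0.
Proof. by rewrite /row_measurable /= preimage_set0. Qed.

Let row_measurableC A : row_measurable A -> row_measurable (~` A).
Proof. by rewrite /row_measurable /= preimage_setC; exact: measurableC. Qed.

Let row_measurableU (F : (set 'rV[R]_n)^nat) :
  (forall i, row_measurable (F i)) -> row_measurable (\bigcup_i F i).
Proof.
by move=> mF; rewrite /row_measurable /= preimage_bigcup;
  exact: bigcupT_measurable.
Qed.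

(* Row vectors carry the vector space structure that tuples lack. *)
HB.instance Definition _ := @isMeasurable.Build default_measure_display
  'rV[R]_n row_measurable row_measurable0 row_measurableC row_measurableU.

Lemma measurable_row_of_tuple : measurable_fun setT row_of_tuple.
Proof. by move=> _ A mA; rewrite setTI. Qed.

Lemma measurable_tuple_of_row : measurable_fun setT tuple_of_row.
Proof.
move=> _ A mA; rewrite setTI /measurable /= /row_measurable /= -comp_preimage.
rewrite (_ : _ \o _ = id) ?preimage_id//.
by apply/funext => t /=; rewrite row_of_tupleK.
Qed.

End row_measurable.

Lemma measurable_coord (R : realType) n (i : 'I_n) :
  measurable_fun setT (fun x : 'rV[R]_n => x ord0 i).
Proof.
rewrite (_ : (fun x => _) = (@tnth n R ^~ i) \o (@tuple_of_row R n)).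
  exact: (measurableT_comp (measurable_tnth i) (@measurable_tuple_of_row R n)).
by apply/funext => x /=; rewrite tnth_mktuple.
Qed.

Section measurable_row_fun.
Context d (T : measurableType d) (R : realType).

Lemma measurable_rowP n (f : T -> 'rV[R]_n) :
  measurable_fun setT f <-> forall i, measurable_fun setT (fun x => f x ord0 i).
Proof.
split=> [mf i|mf].
  exact: (measurableT_comp (measurable_coord i) mf).
rewrite (_ : f = (@row_of_tuple R n) \o (fun x => tuple_of_row (f x))).
  apply: (measurableT_comp (@measurable_row_of_tuple R n)).
  apply/measurable_fun_tnthP => i.
  rewrite (_ : _ \o _ = (fun x => f x ord0 i))//.
  by apply/funext => x /=; rewrite tnth_mktuple.
by apply/funext => x /=; rewrite tuple_of_rowK.
Qed.

Lemma measurable_rowD n (f g : T -> 'rV[R]_n) :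
  measurable_fun setT f -> measurable_fun setT g ->
  measurable_fun setT (fun x => f x + g x).
Proof.
move=> /measurable_rowP mf /measurable_rowP mg; apply/measurable_rowP => i.
under eq_fun do rewrite mxE; exact: measurable_funD.
Qed.

Lemma measurable_mulmx n m (f : T -> 'rV[R]_n) (M : 'M[R]_(n, m)) :
  measurable_fun setT f -> measurable_fun setT (fun x => f x *m M).
Proof.
move=> /measurable_rowP mf; apply/measurable_rowP => i.
under eq_fun do rewrite mxE.
by apply: measurable_sum => j; exact: measurable_funM.
Qed.

Lemma measurable_rowZ n (f : T -> R) (g : T -> 'rV[R]_n) :
  measurable_fun setT f -> measurable_fun setT g ->
  measurable_fun setT (fun x => f x *: g x).
Proof.
move=> mf /measurable_rowP mg; apply/measurable_rowP => i.
under eq_fun do rewrite mxE; exact: measurable_funM.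
Qed.

End measurable_row_fun.

(** * Sections and Fubini *)

Lemma product_sigma_finite d1 d2 (T1 : measurableType d1)
    (T2 : measurableType d2) (R : realType)
    (m1 : {sigma_finite_measure set T1 -> \bar R})
    (m2 : {sigma_finite_measure set T2 -> \bar R}) :
  sigma_finite setT (m1 \x m2)%E.
Proof.
have /sigma_finiteP[F [FT ndF mF]] := sigma_finiteT m1.
have /sigma_finiteP[G [GT ndG mG]] := sigma_finiteT m2.
exists (fun n => F n `*` G n) => [|n].
  apply/seteqP; split=> // -[x y] _.
  have [n _ Fx] : (\bigcup_n F n) x by rewrite -FT.
  have [k _ Gy] : (\bigcup_n G n) y by rewrite -GT.
  exists (n + k)%N => //; split => /=.
    by have /subsetPset := ndF _ _ (leq_addr k n); exact.
  by have /subsetPset := ndG _ _ (leq_addl n k); exact.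
have [[mFn Fn] [mGn Gn]] := (mF n, mG n).
split; first exact: measurableX.
by rewrite product_measure1E// lte_mul_pinfty// ge0_fin_numE.
Qed.

Section sections.
Context d1 d2 (T1 : measurableType d1) (T2 : measurableType d2) (R : realType).
Variables (m1 : {sigma_finite_measure set T1 -> \bar R}).
Variables (m2 : {sigma_finite_measure set T2 -> \bar R}).
Variables (P : set (T1 * T2)) (mP : measurable P).

Let xsectionE x : xsection P x = [set y | P (x, y)].
Proof. by apply/seteqP; split => y; rewrite /xsection /= inE. Qed.

Let ysectionE y : ysection P y = [set x | P (x, y)].
Proof. by apply/seteqP; split => x; rewrite /ysection /= inE. Qed.

Lemma measurable_fun_sectionl : measurable_fun setT (fun x =>
  m2 [set y | P (x, y)]).
Proof.
under eq_fun do rewrite -xsectionE; exact: (measurable_fun_xsection m2 mP).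
Qed.

Lemma measurable_fun_sectionr : measurable_fun setT (fun y =>
  m1 [set x | P (x, y)]).
Proof.
under eq_fun do rewrite -ysectionE; exact: (measurable_fun_ysection m1 mP).
Qed.

Lemma integral_sections :
  (\int[m1]_x m2 [set y | P (x, y)] = \int[m2]_y m1 [set x | P (x, y)])%E.
Proof.
under eq_integral do rewrite -xsectionE.
under [RHS]eq_integral do rewrite -ysectionE.
have := indic_fubini_tonelli m1 m2 mP.
by rewrite indic_fubini_tonelli_FE// indic_fubini_tonelli_GE.
Qed.

End sections.

Section image_measure.
Context d1 d2 (T1 : measurableType d1) (T2 : measurableType d2) (R : realType).
Variables (m : {measure set T1 -> \bar R}) (f : T1 -> T2).
Hypothesis mf : measurable_fun setT f.

Let nu := pushforward m f.

Let nu0 : nu set0 = 0%E. Proof. exact: measure0. Qed.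

Let nu_ge0 A : (0 <= nu A)%E. Proof. exact: measure_ge0. Qed.

Let nu_sigma_additive : semi_sigma_additive nu.
Proof. exact: measure_semi_sigma_additive. Qed.

HB.instance Definition _ := isMeasure.Build _ _ _ nu nu0 nu_ge0
  nu_sigma_additive.

Definition pushforward_measure : {measure set T2 -> \bar R} := nu.

Variables (m_sfin : sigma_finite setT m) (g : T2 -> T1).
Hypotheses (mg : measurable_fun setT g) (fK : cancel f g).

Let nu_sigma_finite : sigma_finite setT nu.
Proof.
have [F FT Foo] := m_sfin.
exists (fun n => g @^-1` F n).
  by rewrite -preimage_bigcup -FT preimage_setT.
move=> n; have [mF Fn] := Foo n; split.
  by rewrite -[X in measurable X]setTI; exact: mg.
rewrite /nu /pushforward -comp_preimage (_ : g \o f = id) ?preimage_id//.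
by apply/funext => x /=; rewrite fK.
Qed.

HB.instance Definition _ := @Measure_isSigmaFinite.Build _ _ _ nu
  nu_sigma_finite.

(** The measurable left inverse [g] of [f] transports a sigma-finite exhaustion;
    the image of a sigma-finite measure need not be sigma-finite in general. *)
Definition iso_measure : {sigma_finite_measure set T2 -> \bar R} := nu.

End image_measure.

(** * Lebesgue measure on row vectors *)

Section cons_row.
Context (R : realType) (k : nat).

Definition cons_row (p : measurableTypeR R * 'rV[R]_k) : 'rV[R]_k.+1 :=
  row_mx (p.1 : R)%:M p.2.

Definition uncons_row (x : 'rV[R]_k.+1) : measurableTypeR R * 'rV[R]_k :=
  (x ord0 ord0, \row_i x ord0 (lift ord0 i)).

Lemma cons_rowE0 p : cons_row p ord0 ord0 = p.1.
Proof.
have -> : ord0 = lshift k ord0 :> 'I_(1 + k) by exact: val_inj.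
by rewrite /cons_row (@row_mxEl _ 1 1 k) mxE mulr1n.
Qed.

Lemma cons_rowES p i : cons_row p ord0 (lift ord0 i) = p.2 ord0 i.
Proof.
have -> : lift ord0 i = rshift 1 i :> 'I_(1 + k) by exact: val_inj.
by rewrite /cons_row (@row_mxEr _ 1 1 k).
Qed.

Lemma cons_rowK : cancel cons_row uncons_row.
Proof.
move=> [t y]; rewrite /uncons_row cons_rowE0; congr pair.
by apply/rowP => i; rewrite mxE cons_rowES.
Qed.

Lemma uncons_rowK : cancel uncons_row cons_row.
Proof.
move=> x; apply/rowP => i; case: (unliftP ord0 i) => [j|] ->.
  by rewrite cons_rowES mxE.
by rewrite cons_rowE0.
Qed.

Lemma measurable_cons_row : measurable_fun setT cons_row.
Proof.
apply/measurable_rowP => i; case: (unliftP ord0 i) => [j|] ->.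
  under eq_fun do rewrite cons_rowES.
  exact: (measurableT_comp (measurable_coord j) measurable_snd).
by under eq_fun do rewrite cons_rowE0; exact: measurable_fst.
Qed.

Lemma measurable_uncons_row : measurable_fun setT uncons_row.
Proof.
apply: measurable_fun_pair; first exact: measurable_coord.
apply/measurable_rowP => i; under eq_fun do rewrite mxE;
  exact: measurable_coord.
Qed.

End cons_row.

Section leb.
Context (R : realType).

Definition leb0 : {sigma_finite_measure set 'rV[R]_0 -> \bar R} :=
  \d_(0 : 'rV[R]_0).

Section lebS.
Context (k : nat) (m : {sigma_finite_measure set 'rV[R]_k -> \bar R}).

Definition lebS := iso_measure (@measurable_cons_row R k)
  (product_sigma_finite (@lebesgue_measure R) m)
   (@measurable_uncons_row R k) (@cons_rowK R k).
End lebS.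

(** The measure underlying [vol]. Unlike the bare recursive set function, it is
    a sigma-finite measure by construction, so Fubini applies to it. *)
Fixpoint leb n : {sigma_finite_measure set 'rV[R]_n -> \bar R} :=
  match n with
  | 0 => leb0
  | k.+1 => lebS (leb k)
  end.

(** Both sides unfold to the same iterated integral of sections, so they agree
    even on sets that are not measurable. *)
Lemma lebesgue_tupleE n (A : set (n.-tuple R)) :
  lebesgue_tuple A = leb n [set x | A (tuple_of_row x)].
Proof.
elim: n => [|k IH] in A *.
  rewrite /= !diracE
    (_ : (0 \in [set x | A (tuple_of_row x)]) = ([tuple] \in A))//.
  by apply/idP/idP; rewrite !inE /= [tuple_of_row _]tuple0.
rewrite [LHS]/= [RHS]/= /pushforward /product_measure1.
apply: eq_integral => t _ /=; rewrite IH; congr (leb k _).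
apply/seteqP; split => y; rewrite /xsection /= !inE /=;
  have -> // : tuple_of_row (cons_row (t, y)) = [tuple of t :: tuple_of_row y];
  apply: eq_from_tnth => i; rewrite tnth_mktuple;
  case: (unliftP ord0 i) => [j|] ->;
  by rewrite ?cons_rowES ?cons_rowE0 ?tnthS ?tnth0 ?tnth_mktuple.
Qed.

Lemma lebSE k (A : set 'rV[R]_k.+1) :
  leb k.+1 A = (\int[lebesgue_measure]_t leb k [set y | A (cons_row (t, y))])%E.
Proof.
rewrite [LHS]/= /pushforward /product_measure1; apply: eq_integral => t _ /=.
by congr (leb k _); apply/seteqP; split => y; rewrite /xsection /= inE.
Qed.

Lemma measurable_row_section k (A : set 'rV[R]_k.+1) (t : R) : measurable A ->
  measurable [set y | A (cons_row (t, y))].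
Proof.
move=> mA; apply: (measurable_preimage _ mA).
exact: (measurableT_comp (@measurable_cons_row R k) (measurable_pair1 t)).
Qed.

Lemma measurable_fun_row_section k (A : set 'rV[R]_k.+1) : measurable A ->
  measurable_fun setT (fun t : R => leb k [set y | A (cons_row (t, y))]).
Proof.
move=> mA; apply: (measurable_fun_sectionl (leb k)
  (P := @cons_row R k @^-1` A)).
exact: (measurable_preimage (@measurable_cons_row R k)).
Qed.

Lemma measurable_fun_chord k (A : set 'rV[R]_k.+1) : measurable A ->
  measurable_fun setT (fun y =>
    lebesgue_measure [set t : R | A (cons_row (t, y))]).
Proof.
move=> mA; apply: (measurable_fun_sectionr (@lebesgue_measure R)
  (P := @cons_row R k @^-1` A)).
exact: (measurable_preimage (@measurable_cons_row R k)).
Qed.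

Lemma leb_chordE k (A : set 'rV[R]_k.+1) : measurable A -> leb k.+1 A =
  (\int[leb k]_y lebesgue_measure [set t : R | A (cons_row (t, y))])%E.
Proof.
move=> mA; rewrite lebSE.
apply: (integral_sections (@lebesgue_measure R) (leb k)
  (P := @cons_row R k @^-1` A)).
exact: (measurable_preimage (@measurable_cons_row R k)).
Qed.

Section leb_fubini.
Context (k : nat) (f : 'rV[R]_k.+1 -> \bar R).
Hypotheses (mf : measurable_fun setT f) (f0 : forall x, (0 <= f x)%E).
Local Open Scope ereal_scope.

Let mfc : measurable_fun setT (f \o @cons_row R k).
Proof. exact: (measurableT_comp mf (@measurable_cons_row R k)). Qed.

Let ge0_fc x : 0 <= (f \o @cons_row R k) x. Proof. exact: f0. Qed.

Let integral_lebS :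
  \int[leb k.+1]_x f x = \int[lebesgue_measure \x leb k]_p f (cons_row p).
Proof.
transitivity (\int[pushforward (lebesgue_measure \x leb k)
  (@cons_row R k)]_x f x).
  by [].
by rewrite ge0_integral_pushforward//; exact: measurable_cons_row.
Qed.

Lemma integral_lebS_row :
  \int[leb k.+1]_x f x = \int[leb k]_y \int[lebesgue_measure]_t
    f (cons_row (t, y)).
Proof. by rewrite integral_lebS (fubini_tonelli2 (f \o @cons_row R k)). Qed.

Lemma measurable_integral_line :
  measurable_fun setT (fun y => \int[lebesgue_measure]_t f (cons_row (t, y))).
Proof. exact: (measurable_fun_fubini_tonelli_G (f \o @cons_row R k)). Qed.

End leb_fubini.

(** * Outer volume *)

Lemma volE n (A : set 'rV[R]_n) : measurable A -> vol A = leb n A.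
Proof.
move=> mA; rewrite /vol (_ : lebesgue_tuple (n:=n) =
  pushforward (leb n) (@tuple_of_row R n)).
  rewrite measurable_mu_extE; last exact: mA.
    exact: measurable_tuple_of_row.
  move=> mtr; rewrite /= /pushforward (_ : _ @^-1` _ = A)//.
  by apply/seteqP; split => x /=; rewrite -/(row_of_tuple _) tuple_of_rowK.
by apply/funext => B; rewrite lebesgue_tupleE.
Qed.

Lemma le_vol n (A B : set 'rV[R]_n) : A `<=` B -> (vol A <= vol B)%E.
Proof. by move=> AB; apply: le_mu_ext => t; exact: AB. Qed.

Lemma vol_ge0 n (A : set 'rV[R]_n) : (0 <= vol A)%E.
Proof. by apply: mu_ext_ge0 => B; rewrite lebesgue_tupleE. Qed.

(** Outer volumes of arbitrary sets are handled through such a hull. When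
    [vol A] is finite, it is the intersection of the unions of countable covers
    whose total measures tend to [vol A]. *)
Lemma vol_hull n (A : set 'rV[R]_n) :
  exists G, [/\ measurable G, A `<=` G & leb n G = vol A].
Proof.
have [voo|vfin] := eqVneq (vol A) +oo%E.
  exists setT; split => //; apply/eqP; rewrite -volE//.
  by rewrite eq_le {1}voo leey /= le_vol.
have {}vfin : vol A \is a fin_num by rewrite ge0_fin_numE ?vol_ge0// ltey.
have H (m : nat) : exists G, [/\ measurable G,
  A `<=` G & (leb n G <= vol A + m.+1%:R^-1%:E)%E].
  have e0 : (0 < m.+1%:R^-1 :> R) by rewrite invr_gt0.
  have [_ /= [F [mF AF] <-] Fe] := lb_ereal_inf_adherent e0 vfin.
  exists (\bigcup_i ((@row_of_tuple R n) @` F i)).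
  have mF' i : measurable ((@row_of_tuple R n) @` F i).
    rewrite /measurable /= /row_measurable /=.
    rewrite (_ : _ @^-1` _ = F i)//.
    apply/seteqP; split => [t [s Fs /(can_inj (@row_of_tupleK R n)) <-]//|t Ft].
    by exists t.
  split.
  - exact: bigcupT_measurable.
  - move=> x Ax; have /AF[i _ Fi] :
    [set t | A (row_of_tuple t)] (tuple_of_row x).
      by rewrite /= tuple_of_rowK.
    by exists i => //; exists (tuple_of_row x) => //; rewrite tuple_of_rowK.
  - apply: le_trans (ltW Fe).
    apply: le_trans (measure_sigma_subadditive (leb n) mF' _ _) _ => //.
      exact: bigcupT_measurable.
    apply: lee_nneseries => // i _.
    have mFt : measurable [set x | F i (tuple_of_row x)].
      exact: (measurable_preimage (@measurable_tuple_of_row R n)).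
    rewrite lebesgue_tupleE le_measure ?inE//.
    by move=> _ [t Ft <-] /=; rewrite row_of_tupleK.
have [G GH] := choice H.
exists (\bigcap_m G m); split.
- by apply: bigcapT_measurable => m; have [] := GH m.
- by move=> x Ax m _; have [_ + _] := GH m; apply.
- apply/eqP; rewrite eq_le; apply/andP; split; last first.
    rewrite -volE; first by apply: le_vol => x Ax m _; have [_ + _] := GH m;
      apply.
    by apply: bigcapT_measurable => m; have [] := GH m.
  apply/lee_addgt0Pr => e e0.
  have [m _ me] := near_infty_natSinv_lt (PosNum e0).
  have [mG _ Gm] := GH m.
  apply: (@le_trans _ _ (leb n (G m))).
    apply: le_measure; rewrite ?inE//; last exact: bigcap_inf.
    by apply: bigcapT_measurable => m'; have [] := GH m'.
  apply: le_trans Gm _; rewrite leeD2l// lee_fin ltW//; apply: me => /=.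
  exact: leqnn.
Qed.
End leb.

(** * Affine and linear maps *)

Section affine.
Context (R : realType).

Lemma measurable_affine (c s : R) :
  measurable_fun setT (fun t : R => c + s * t).
Proof. by apply: measurable_funD => //; exact: measurable_funM. Qed.

(** Both sides, multiplied by [s], are measures that agree on half-open
    intervals. *)
Lemma lebesgue_measure_affine (c s : R) (A : set R) : 0 < s -> measurable A ->
  lebesgue_measure [set t : R | A (c + s * t)] =
    (s^-1%:E * lebesgue_measure A)%E.
Proof.
move=> s0 mA; have maff := measurable_affine c s.
have maff' : measurable_fun setT (fun t : measurableTypeR R =>
    (c + s * t : measurableTypeR R)) by exact: maff.
pose m := mscale (NngNum (ltW s0)) (pushforward_measure
  (@lebesgue_measure R) maff').
have mE : forall X, ocitv X -> lebesgue_measure X = m X.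
  move=> _ [[a b] /= _ <-].
  rewrite /m /mscale /= /pushforward
      (_ : _ @^-1` _ = `](a - c) / s, (b - c) / s]%classic).
    rewrite !lebesgue_measure_itv /= !lte_fin.
    rewrite ltr_pM2r ?invr_gt0// ltrD2r; case: ifPn => _; last by rewrite mule0.
    rewrite -!EFinD -EFinM; congr (_%:E); field; lra.
  apply/seteqP; split => t;
    rewrite /= !in_itv /= ler_pdivlMr// ltr_pdivrMr// ltrBlDl lerBrDl;
    by rewrite [t * s]mulrC.
have -> := lebesgue_measure_unique mE mA.
by rewrite /m /mscale /= /pushforward muleA -EFinM mulVf ?mul1e// gt_eqF.
Qed.

Lemma integral_affine (c s : R) (f : R -> \bar R) : 0 < s ->
  measurable_fun setT f -> (forall t, (0 <= f t)%E) ->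
  (\int[lebesgue_measure]_t f (c + s * t)%R =
    s^-1%:E * \int[lebesgue_measure]_t f t)%E.
Proof.
move=> s0 mf f0; have maff := measurable_affine c s.
have s'0 : 0 <= s^-1 by rewrite invr_ge0 ltW.
have maff' : measurable_fun setT (fun t : measurableTypeR R =>
    (c + s * t : measurableTypeR R)) by exact: maff.
transitivity (\int[pushforward_measure (@lebesgue_measure R) maff']_t f t)%E.
  by rewrite /= ge0_integral_pushforward.
transitivity (\int[mscale (NngNum s'0) (@lebesgue_measure R)]_t f t)%E.
  apply: eq_measure_integral => A mA _.
  by rewrite /mscale /= /pushforward /preimage lebesgue_measure_affine.
by rewrite ge0_integral_mscale.
Qed.

Lemma leb_affine n (c : 'rV[R]_n) (s : R) (A : set 'rV[R]_n) : 0 < s ->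
  measurable A ->
  leb R n [set x | A (c + s *: x)] = ((s ^- n)%:E * leb R n A)%E.
Proof.
move=> s0; elim: n => [|k IH] in c A *; move=> mA.
  rewrite expr0 invr1 mul1e; congr (leb R 0 _); apply/seteqP.
  by split => x /=; rewrite (_ : c + s *: x = x)//; apply/rowP => -[].
pose c' := (uncons_row c).2; pose c0 : R := c ord0 ord0.
have consE t y : c + s *: cons_row (t, y) = cons_row (c0 + s * t, c' + s *: y).
  apply/rowP => i; rewrite 2!mxE; case: (unliftP ord0 i) => [j|] ->.
    by rewrite !cons_rowES 3!mxE.
  by rewrite !cons_rowE0.
rewrite !lebSE.
under eq_integral => t _.
  rewrite (_ : [set y | _] =
      [set y | [set z | A (cons_row (c0 + s * t, z))] (c' + s *: y)]);
        last first.
    by apply/seteqP; split => y /=; rewrite consE.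
  rewrite IH; last exact: measurable_row_section.
  over.
have mF := measurable_fun_row_section mA.
rewrite /= ge0_integralZl//; last 2 first.
- exact: (measurableT_comp mF (measurable_affine c0 s)).
- by rewrite lee_fin invr_ge0 exprn_ge0// ltW.
rewrite (integral_affine _ s0 mF)//.
by rewrite muleA -EFinM -invfM -exprSr.
Qed.

Lemma leb_translate n (c : 'rV[R]_n) (A : set 'rV[R]_n) : measurable A ->
  leb R n [set x | A (c + x)] = leb R n A.
Proof.
move=> mA; have := leb_affine c ltr01 mA.
by under eq_set do rewrite scale1r; rewrite expr1n invr1 mul1e.
Qed.

(** A set of measure one: it fixes the normalization in [leb_linear] and, being
    bounded with nonempty interior, serves to compare other sets with. *)
Definition unit_cube n : set 'rV[R]_n := [set x | forall i, 0 <= x ord0 i <= 1].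

Lemma measurable_unit_cube n : measurable (@unit_cube n).
Proof.
rewrite (_ : @unit_cube n = \bigcap_(i in [set: 'I_n])
  [set x : 'rV[R]_n | 0 <= x ord0 i <= 1]).
  apply: fin_bigcap_measurable => // i _.
  have := measurable_preimage (@measurable_coord R n i)
    (@measurable_itv R `[0, 1]).
  by under eq_set do rewrite in_itv.
by apply/seteqP; split => x /= H i; [move=> _|]; exact: H.
Qed.

Lemma leb_unit_cube n : leb R n (@unit_cube n) = 1%E.
Proof.
elim: n => [|k IH].
  by rewrite /= diracE mem_set// => -[].
rewrite lebSE.
transitivity (\int[@lebesgue_measure R]_t
    (\1_(`[0, 1]%classic : set (measurableTypeR R)) t)%:E)%E; last first.
  rewrite integral_indic//= setIT;
    apply: etrans (lebesgue_measure_itv `[0, 1]) _.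
  by rewrite /= lte01 oppr0 adde0.
apply: eq_integral => t _; rewrite indicE;
  have [t01|t01] := boolP (0 <= (t : R) <= 1).
  rewrite mem_set /= ?in_itv//= -IH; congr (leb R k _); apply/seteqP;
    split => y /= H i.
    by have := H (lift ord0 i); rewrite cons_rowES.
  by case: (unliftP ord0 i) => [j|] ->; rewrite ?cons_rowES ?cons_rowE0//;
    exact: H.
rewrite memNset /= ?in_itv /=; last exact/negP.
rewrite (_ : [set y | _] = set0) ?measure0//; apply/seteqP;
  split => // y /= /(_ ord0).
by rewrite cons_rowE0 (negbTE t01).
Qed.

(** The classical uniqueness argument for Haar measure. Both sides compute the
    measure of the set of pairs (x, z) with B z and A (x + z M): slicing at a
    fixed z gives the left-hand side, since A may be translated; slicing at a
    fixed x and translating z by x M' turns the set into that of the pairs with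
    A (z M) and B (z - x M'), and slicing at a fixed z again gives the
    right-hand side. *)
Lemma leb_linear_swap n d (M : 'M[R]_(n, d)) (M' : 'M[R]_(d, n))
    (A : set 'rV[R]_d) (B : set 'rV[R]_n) :
  M *m M' = 1%:M -> M' *m M = 1%:M -> measurable A -> measurable B ->
  (leb R d A * leb R n B =
   leb R n [set z | A (z *m M)%R] *
   leb R d [set x : 'rV[R]_d | B (- (x *m M'))%R])%E.
Proof.
move=> MM' M'M mA mB.
have mM : measurable_fun setT (fun z : 'rV[R]_n => z *m M)
  by exact: measurable_mulmx.
have mfst := @measurable_fst _ _ 'rV[R]_d 'rV[R]_n.
have msnd := @measurable_snd _ _ 'rV[R]_d 'rV[R]_n.
have mAz : measurable [set z | A (z *m M)] by exact: (measurable_preimage mM).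
have mN : measurable_fun setT (fun x : 'rV[R]_d => - (x *m M')).
  under eq_fun do rewrite -mulmxN; exact: measurable_mulmx.
have mBx : measurable [set x : 'rV[R]_d | B (- (x *m M'))%R]
  by exact: (measurable_preimage mN).
pose P := [set p : 'rV[R]_d * 'rV[R]_n | B p.2 /\ A (p.1 + p.2 *m M)].
have mP : measurable P.
  apply: measurableI; first exact: (measurable_preimage msnd).
  apply: (measurable_preimage _ mA).
  by apply: measurable_rowD => //; exact: measurable_mulmx.
pose P' := [set p : 'rV[R]_d * 'rV[R]_n |
  A (p.2 *m M) /\ B (p.2 + - (p.1 *m M'))].
have mP' : measurable P'.
  apply: measurableI; first exact: (measurable_preimage msnd mAz).
  apply: (measurable_preimage _ mB).
  by apply: measurable_rowD => //; exact: (measurableT_comp mN mfst).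
transitivity (\int[leb R d]_x leb R n [set z | P (x, z)])%E.
  rewrite integral_sections// (eq_integral (fun z =>
    leb R d A * (\1_B z)%:E)%E).
    by rewrite ge0_integralZl// ?integral_indic ?setIT//;
      exact: measurableT_comp.
  move=> z _; rewrite indicE; have [Bz|Bz] := pselect (B z).
    rewrite mem_set// mule1 -(leb_translate (z *m M) mA); congr (leb R d _);
      apply/seteqP.
    by split => x /=; rewrite addrC; [case|].
  rewrite memNset// mule0 (_ : [set x | _] = set0) ?measure0//.
  by apply/seteqP; split => // x [].
transitivity (\int[leb R d]_x leb R n [set z | P' (x, z)])%E.
  apply: eq_integral => x _.
  rewrite -(@leb_translate _ (x *m M') [set z | P' (x, z)]).
    have E1 z : (x *m M' + z) *m M = x + z *m M
      by rewrite mulmxDl -mulmxA M'M mulmx1.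
    have E2 z : x *m M' + z - x *m M' = z by rewrite addrAC subrr add0r.
    by congr (leb R n _); apply/seteqP; split => z;
      rewrite /P /P' /= E1 E2 => -[].
  by apply: (measurable_preimage _ mP'); exact: measurable_pair1.
rewrite integral_sections// (eq_integral (fun z =>
    (\1_[set z : 'rV[R]_n | A (z *m M)%R] z)%:E *
    leb R d [set x : 'rV[R]_d | B (- (x *m M'))%R])%E).
  by rewrite ge0_integralZr// ?integral_indic ?setIT//; exact: measurableT_comp.
move=> z _; rewrite indicE; have [Az|Az] := pselect (A (z *m M)).
  rewrite mem_set// mul1e -[RHS](leb_translate (- z *m M) mBx).
  have E x : - ((- z *m M + x) *m M') = z - x *m M'.
    by rewrite mulmxDl !mulNmx -mulmxA MM' mulmx1 opprD opprK.
  by congr (leb R d _); apply/seteqP; split => x; rewrite /P' /= E => // -[].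
rewrite memNset// mul0e (_ : [set x | _] = set0) ?measure0//.
by apply/seteqP; split => // x [].
Qed.

(** The factor is the absolute value of the determinant of [M]. *)
Lemma leb_linear n d (M : 'M[R]_(n, d)) (M' : 'M[R]_(d, n)) :
  M *m M' = 1%:M -> M' *m M = 1%:M ->
  exists2 c : R, 0 < c & forall A : set 'rV[R]_d, measurable A ->
    leb R d A = (c%:E * leb R n [set z | A (z *m M)%R])%E.
Proof.
move=> MM' M'M.
(* The cube in the z-space identifies the factor, the cube in the x-space
   shows that it is neither zero nor infinite. *)
pose c := leb R d [set x | unit_cube (- (x *m M'))].
have cE A : measurable A -> (leb R d A = leb R n [set z | A (z *m M)%R] * c)%E.
  move=> mA; have := leb_linear_swap MM' M'M mA (@measurable_unit_cube n).
  by rewrite leb_unit_cube mule1.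
have c0 : (0 <= c)%E by exact: measure_ge0.
have := cE _ (@measurable_unit_cube d); rewrite leb_unit_cube.
have : (0 <= leb R n [set z | unit_cube (z *m M)%R])%E by exact: measure_ge0.
case: (leb R n _) => [r| |]//; case: c c0 cE => [c| |]// c0 cE r0.
- move=> /eqP; rewrite -EFinM eqe => /eqP E; exists c.
    by rewrite lt_neqAle -lee_fin c0 andbT; apply/eqP => c'; move/eqP: E;
      rewrite -c' mulr0 oner_eq0.
  by move=> A mA; rewrite cE// muleC.
- move: r0; rewrite lee_fin le_eqVlt => /predU1P[<-|r0];
  first by rewrite mul0e => -[/eqP]; rewrite oner_eq0.
  by rewrite gt0_muley.
- move: c0; rewrite lee_fin le_eqVlt => /predU1P[<-|c0];
  first by rewrite mule0 => -[/eqP]; rewrite oner_eq0.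
  by rewrite gt0_mulye.
Qed.

Lemma integral_leb_linear n d (M : 'M[R]_(n, d)) (M' : 'M[R]_(d, n)) :
  M *m M' = 1%:M -> M' *m M = 1%:M ->
  exists2 c : R, 0 < c & forall f : 'rV[R]_d -> \bar R, measurable_fun setT f ->
    (forall x, (0 <= f x)%E) ->
    (\int[leb R d]_x f x = c%:E * \int[leb R n]_z f (z *m M)%R)%E.
Proof.
move=> MM' M'M; have [c c0 cE] := leb_linear MM' M'M; exists c => // f mf f0.
have mM : measurable_fun setT (fun z : 'rV[R]_n => z *m M)
  by exact: measurable_mulmx.
have c0' := ltW c0.
transitivity (\int[mscale (NngNum c0') (pushforward_measure
  (leb R n) mM)]_x f x)%E.
  by apply: eq_measure_integral => A mA _; exact: etrans (cE _ mA) _.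
by rewrite ge0_integral_mscale// ge0_integral_pushforward.
Qed.

End affine.

(** * Chords and shadow of a convex set *)

Lemma integral_onemXn (R : realType) k :
  (\int[@lebesgue_measure R]_(s in `]0%R, 1%R[) ((1 - s) ^+ k)%:E =
   (k.+1%:R^-1)%:E)%E.
Proof.
rewrite -Rintegral_onemXn /Rintegral fineK.
  rewrite [RHS]integral_itv_bndoo//; apply/measurable_EFinP/measurable_funX.
  exact: measurable_funB.
apply: integrable_fin_num => //; apply: continuous_compact_integrable.
  exact: segment_compact.
by apply: continuous_in_subspaceT => x _; exact: continuous_onemXn.
Qed.

(** The first coordinate is the direction of the chords. The shadow of [L] along
    it is the set of all [y] over which [L] has a point. *)
Section convex_chord.
Context (R : realType) (k : nat) (L : set 'rV[R]_k.+1).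
Hypothesis mL : measurable L.
Hypothesis cvxL : forall (x y : 'rV[R]_k.+1) (s : R), 0 <= s <= 1 -> L x ->
  L y -> L ((1 - s) *: x + s *: y).

Let chord (y : 'rV[R]_k) : set R := [set t | L (cons_row (t, y))].
Let h y := lebesgue_measure (chord y).

Let mchord y : measurable (chord y).
Proof.
apply: (measurable_preimage _ mL).
exact: (measurableT_comp (@measurable_cons_row R k) (measurable_pair2 y)).
Qed.

(** The triangle spanned by the chord over [y0] and by the point of [L] over [y]
    lies in [L]. *)
Lemma chord_interpolation (y0 y : 'rV[R]_k) (s t : R) : 0 <= s < 1 ->
  L (cons_row (t, y)) ->
  ((1 - s)%:E * h y0 <= h ((1 - s) *: y0 + s *: y)%R)%E.
Proof.
move=> /andP[s0 s1] Lt.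
(* The chord over (1 - s) y0 + s y contains the image of the chord over y0
   under r |-> (1 - s) r + s t; the set below is that image. *)
pose s' := (1 - s)^-1.
have s'0 : 0 < s' by rewrite invr_gt0 subr_gt0.
have -> : ((1 - s)%:E * h y0 = lebesgue_measure
  [set r : R | chord y0 (- (s * t) * s' + s' * r)%R])%E.
  by rewrite lebesgue_measure_affine// invrK.
apply: le_measure; rewrite ?inE.
- exact: (measurable_preimage (measurable_affine _ _)).
- exact: mchord.
move=> r /= Lr; have s01 : 0 <= s <= 1 by rewrite s0 ltW.
rewrite /chord /=.
have -> : cons_row (r, (1 - s) *: y0 + s *: y) =
    (1 - s) *: cons_row (- (s * t) * s' + s' * r, y0) + s *: cons_row (t, y).
  apply/rowP => i; rewrite [RHS]mxE [X in _ = X + _]mxE [X in _ = _ + X]mxE.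
  case: (unliftP ord0 i) => [j|] ->; first by rewrite !cons_rowES 3!mxE.
  rewrite !cons_rowE0 /= mulrDr mulrCA [_ * (s' * r)]mulrA /s' divff; last lra.
  by rewrite mulr1 mul1r addrAC addNr add0r.
exact: cvxL.
Qed.

Lemma measurable_pair2_section (P : set (measurableTypeR R * 'rV[R]_k)) y :
  measurable P -> measurable [set s : R | P (s, y)].
Proof. exact: (measurable_preimage (measurable_pair2 y)). Qed.

(** By interpolation the chords of length at least [s * m] fill a copy of the
    shadow shrunk by [1 - s]. Integrating the measures of these level sets over
    all lengths up to [m], which bounds the measure of [L] from below, yields
    the integral of (1 - s)^k. A finite lower bound [m] stands for the chord,
    which may be infinite. *)
Lemma shadow_chord y0 (m : R) : 0 <= m -> (m%:E <= h y0)%E ->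
  (m%:E * vol [set y | exists t, L (cons_row (t, y))] <=
   k.+1%:R%:E * leb R k.+1 L)%E.
Proof.
set T := [set y | _]; rewrite le_eqVlt => /predU1P[<- _|m0 mh].
  by rewrite mul0e mule_ge0.
have vT0 : (0 <= vol T)%E by exact: vol_ge0.
have mh' : measurable_fun setT h by exact: measurable_fun_chord.
have level s : 0 < s < 1 ->
    (((1 - s) ^+ k)%:E * vol T <= leb R k [set y | ((s * m)%:E <= h y)%E])%E.
  move=> /andP[s0 s1]; set H := [set y | _].
  have mH : measurable H by rewrite -[H]setTI; exact: measurable_lee.
  have s'0 : 0 < 1 - s by lra.
  rewrite -(@lee_pdivlMl R) ?exprn_gt0//.
  rewrite -(@leb_affine R k (s *: y0) (1 - s))//.
  rewrite -volE; last first.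
    apply: (measurable_preimage _ mH).
    by apply: measurable_rowD => //; exact: measurable_rowZ.
  apply: le_vol => y [t Lt]; rewrite /H /=.
  have s1' : 0 <= 1 - s < 1 by lra.
  have := chord_interpolation y0 s1' Lt; rewrite subKr; apply: le_trans.
  by rewrite EFinM lee_pmul2l// lte_fin.
(* Layer cake: P is the region under the chord function, cut at height m and
   rescaled to height 1. *)
pose P := [set p : measurableTypeR R * 'rV[R]_k | (0 < (p.1 : R) < 1) /\
  ((p.1 * m)%:E <= h p.2)%E].
have mP : measurable P.
  have m1 : measurable
      [set p : measurableTypeR R * 'rV[R]_k | 0 < (p.1 : R) < 1].
    rewrite (_ : [set p | _] = fst @^-1` (`]0, 1[%classic : set R)).
      exact: (measurable_preimage (@measurable_fst _ _
        (measurableTypeR R) 'rV[R]_k)).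
    by apply/seteqP; split => p /=; rewrite in_itv.
  have m2 : measurable
      [set p : measurableTypeR R * 'rV[R]_k | ((p.1 * m)%:E <= h p.2)%E].
    rewrite -[X in measurable X]setTI; apply: measurable_lee => //.
      by apply/measurable_EFinP; apply: measurable_funM => //;
        exact: measurable_fst.
    exact: (measurableT_comp mh' measurable_snd).
  exact: (measurableI _ _ m1 m2).
have lower : ((k.+1%:R^-1)%:E * vol T <=
    \int[@lebesgue_measure R]_s leb R k [set y | P (s, y)])%E.
  have mPl := measurable_fun_sectionl (leb R k) mP.
  rewrite -integral_onemXn -ge0_integralZr//; last first.
  - by move=> s; rewrite /= in_itv /= => /andP[_ s1];
    rewrite lee_fin exprn_ge0// subr_ge0 ltW.
  - by apply/measurable_EFinP/measurable_funX; exact: measurable_funB.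
  apply: (@le_trans _ _ (\int[@lebesgue_measure R]_(s in `]0%R, 1%R[)
      leb R k [set y | P (s, y)])%E).
    apply: ge0_le_integral => //.
    + move=> s; rewrite /= in_itv /= => /andP[_ s1].
      by rewrite mule_ge0// lee_fin exprn_ge0// subr_ge0 ltW.
    + apply: emeasurable_funM => //.
      by apply/measurable_EFinP/measurable_funX; exact: measurable_funB.
    + exact: measurable_funTS.
    + move=> s; rewrite /= in_itv /= => s01; apply: le_trans (level _ s01) _.
      rewrite (_ : [set y | P (s, y)] = [set y | ((s * m)%:E <= h y)%E])//.
      by apply/seteqP; split => y; rewrite /P /= ?s01 => // -[].
  exact: ge0_subset_integral.
have upper y : (m%:E * lebesgue_measure [set s : R | P (s, y)] <= h y)%E.
  have [hm|hm] := leP m%:E (h y).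
    apply: le_trans hm; rewrite -[leRHS]mule1 lee_pmul2l ?lte_fin//.
    apply: (@le_trans _ _ (@lebesgue_measure R `[0, 1]%classic)).
      apply: le_measure; rewrite ?inE//; first exact: measurable_pair2_section.
      by move=> s [/andP[s0 s1] _]; rewrite /= in_itv /= !ltW.
    by rewrite lebesgue_measure_itv /= lte01 oppr0 adde0.
  have hfin : h y \is a fin_num by rewrite ge0_fin_numE// (lt_trans hm)// ltry.
  have hyE := fineK hfin; set r := fine (h y) in hyE.
  have r0 : 0 <= r by rewrite /r fine_ge0.
  have rm : r < m by rewrite -lte_fin hyE.
  apply: (@le_trans _ _
      (m%:E * @lebesgue_measure R `[0%R, (r / m)%R]%classic)%E).
    rewrite lee_pmul2l ?lte_fin//; apply: le_measure; rewrite ?inE//.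
      exact: measurable_pair2_section.
    move=> s [/andP[s0 s1]]; rewrite -hyE lee_fin => smr.
    by rewrite /= in_itv /= ltW//= ler_pdivlMr.
  rewrite lebesgue_measure_itv /= -hyE; case: ifPn => _;
    last by rewrite mule0 lee_fin.
  by rewrite oppr0 adde0 -EFinM mulrC divfK// gt_eqF.
rewrite leb_chordE// -lee_pdivrMl ?ltr0n// muleCA.
apply: (@le_trans _ _ (\int[leb R k]_y (m%:E * lebesgue_measure
  [set s : R | P (s, y)]))%E).
  rewrite ge0_integralZl_EFin ?(ltW m0)//;
    last exact: (measurable_fun_sectionr (@lebesgue_measure R) mP).
  by rewrite lee_pmul2l ?lte_fin// -integral_sections.
apply: ge0_le_integral => //.
- by move=> y _; rewrite mule_ge0// lee_fin ltW.
- by apply: measurable_funeM;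
  exact: (measurable_fun_sectionr (@lebesgue_measure R) mP).
Qed.

Lemma chord_shadow_le (y0 : 'rV[R]_k) :
  (h y0 * vol [set y | exists t, L (cons_row (t, y))] <=
   k.+1%:R%:E * leb R k.+1 L)%E.
Proof.
have bound := @shadow_chord y0;
  move: (vol _) (vol_ge0 [set y | exists t, L (cons_row (t, y))]) bound.
move=> v v0 bound; have : (0 <= h y0)%E by [].
case: (h y0) bound => [r| |]// bound h0; first exact: bound.
have [->|vn0] := eqVneq v 0%E; first by rewrite mule0 mule_ge0.
have {vn0}v0 : (0 < v)%E by rewrite lt_neqAle eq_sym vn0.
rewrite gt0_mulye//; apply/eqP; rewrite eq_sym; apply/negPn/negP => X.
have {X} : (k.+1%:R%:E * leb R k.+1 L)%E \is a fin_num.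
  by rewrite ge0_fin_numE ?mule_ge0// ltey.
move: (k.+1%:R%:E * _)%E bound => [x| |]// bound _.
case: v v0 bound => [v| |]// v0 bound; last first.
  by have := bound 1 ler01 (leey _); rewrite gt0_muley ?lte_fin.
rewrite lte_fin in v0;
  have m0 : 0 <= (`|x| + 1) / v by rewrite divr_ge0 ?addr_ge0// ltW.
have := bound _ m0 (leey _); rewrite -EFinM lee_fin divfK ?gt_eqF// => xx.
by have := ler_norm x; lra.
Qed.
End convex_chord.

(** * Coordinates adapted to an axis *)

Section frame.
Context (R : realType) (d : nat).
Implicit Types (a v x : 'rV[R]_d).

Lemma dotmx_eq0 v : (v *m v^T == 0) = (v == 0).
Proof.
apply/eqP/eqP => [|->]; last by rewrite mul0mx.
move=> /matrixP /(_ 0 0); rewrite !mxE => /eqP.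
rewrite psumr_eq0 => [/allP H|i _]; last by rewrite mxE -expr2 sqr_ge0.
apply/rowP => i; rewrite mxE; have := H i (mem_index_enum i).
by rewrite mxE /= -expr2 sqrf_eq0 => /eqP.
Qed.

Lemma orthogonalP (m p : nat) (U : 'M[R]_(m, d)) (v : 'M[R]_(p, d)) :
  (v <= orthogonal U)%MS = (v *m U^T == 0).
Proof. by rewrite /orthogonal /orthomx sub_kermx mul1mx map_mx_id. Qed.

(** This holds whether or not the choice of an orthonormal basis succeeds, as
    the default value spans the same subspace. *)
Lemma onb_eqmx (E : 'M[R]_d) : (onb E :=: E)%MS.
Proof.
rewrite /onb; case: xgetP => [Q _ [_ /eqmxP//]|_]; exact: eq_row_base.
Qed.

Context (a : 'rV[R]_d) (a0 : a != 0).
Let E := orthogonal a.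

(** The axis followed by a basis of its orthogonal hyperplane: coordinates in
    which the chords parallel to the axis are the lines of the first
    coordinate. *)
Definition frame : 'M[R]_((\rank (orthogonal a)).+1, d) :=
  col_mx a (onb (orthogonal a)).

Let capaE : (a :&: onb E = 0)%MS.
Proof.
apply/eqP/rowV0P => v; rewrite sub_capmx => /andP[/sub_rVP[s ->]].
rewrite onb_eqmx orthogonalP -scalemxAl scaler_eq0 dotmx_eq0 (negbTE a0) orbF.
by move=> /eqP ->; rewrite scale0r.
Qed.

Let rank_frame : \rank frame = (\rank E).+1.
Proof.
transitivity (\rank (a + onb E)%MS); first by rewrite addsmxE.
have := mxrank_sum_cap a (onb E).
by rewrite capaE mxrank0 addn0 => ->; rewrite rank_rV a0 onb_eqmx.
Qed.

Lemma rank_orthogonal : (\rank E).+1 = d.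
Proof.
have d0 : (0 < d)%N by case: (d) a a0 => // b; rewrite [b]thinmx0 eqxx.
rewrite /E /orthogonal /orthomx mxrank_ker mul1mx map_mx_id// mxrank_tr rank_rV
  a0.
by rewrite subn1 prednK.
Qed.

Lemma frameK : frame *m pinvmx frame = 1%:M.
Proof. by rewrite mulmxVp// /row_free rank_frame. Qed.

Lemma frameVK : pinvmx frame *m frame = 1%:M.
Proof. by rewrite mulVpmx// /row_full rank_frame rank_orthogonal. Qed.

Lemma orthogonal_projection_frame (t : R) (y : 'rV[R]_(\rank E)) :
  orthogonal_projection E (t *: a + y *m onb E) = y *m onb E.
Proof.
have capEE : (E :&: orthogonal E = 0)%MS.
  apply/eqP/rowV0P => v;
    rewrite sub_capmx orthogonalP => /andP[/submxP[w vE]] /eqP vE0.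
  by apply/eqP; rewrite -dotmx_eq0 {2}vE trmx_mul mulmxA vE0 mul0mx.
rewrite /orthogonal_projection mulmxDl proj_mx_0 ?add0r ?proj_mx_id//.
  by rewrite -onb_eqmx submxMl.
rewrite orthogonalP -scalemxAl scaler_eq0; apply/orP; right.
by rewrite -[a]trmxK -trmx_mul trmx_eq0 -orthogonalP.
Qed.

Lemma onb_inj : injective (fun y : 'rV[R]_(\rank E) => y *m onb E).
Proof.
apply: row_free_inj; rewrite /row_free onb_eqmx//.
Qed.
End frame.

(** * Weighing a cylinder *)

Section cylinder_bound.
Context (R : realType) (d : nat) (C : cylinder R d) (K : set 'rV[R]_d).
Let a := axis C.
Let Q := onb (orthogonal a).
Let k := \rank (orthogonal a).

Definition shadow : set 'rV[R]_k := [set y | exists t : R, K (t *: a + y *m Q)].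
Definition trace : set 'rV[R]_k := [set y | cylinder_set C (y *m Q)].

Lemma cons_row_frame t (y : 'rV[R]_k) :
  cons_row (t, y) *m frame a = t *: a + y *m Q.
Proof.
rewrite /cons_row /frame; apply: etrans (@mul_row_col _ 1 1 k d _ _ _ _) _.
by rewrite mul_scalar_mx.
Qed.

Lemma shadowE :
  vol_on (cross_space C) (orthogonal_projection (cross_space C) @` K) =
  vol shadow.
Proof.
rewrite /vol_on; congr vol; apply/seteqP; split=> [y /= [x Kx xy]|y /= [t Kt]].
  have xE : x = x *m pinvmx (frame a) *m frame a
    by rewrite -mulmxA frameVK ?mulmx1// axis_neq0.
  move: xE Kx xy; rewrite -[x *m _](@uncons_rowK R k).
  case: (uncons_row _) => t z; rewrite cons_row_frame => ->; rewrite /= => Kx.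
  rewrite orthogonal_projection_frame ?axis_neq0// => /onb_inj zy.
  by exists t; rewrite -zy.
by exists (t *: a + y *m Q) => //;
  rewrite orthogonal_projection_frame ?axis_neq0.
Qed.

Lemma traceE :
  vol_on (cross_space C)
    (cylinder_set C `&` Defs.subspace (cross_space C)) = vol trace.
Proof.
rewrite /vol_on; congr vol; apply/seteqP; split=> [y [] //|y /= Cy].
split => //; rewrite /Defs.subspace /=.
by apply: (submx_trans (submxMl _ _)); rewrite onb_eqmx.
Qed.

Lemma trace_cylinder t (y : 'rV[R]_k) :
  cylinder_set C (t *: a + y *m Q) -> trace y.
Proof.
move=> [x xa [b Bb xb]]; exists (x - t *: a).
  by rewrite /Defs.subspace /= addmx_sub ?eqmx_opp ?scalemx_sub.
by exists b => //; rewrite addrAC xb addrAC subrr add0r.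
Qed.

Local Open Scope ereal_scope.

Section weight.
Variables (D : R) (f : 'rV[R]_d -> \bar R).
Hypotheses (mf : measurable_fun setT f) (f0 : forall x, 0 <= f x).
Hypothesis fK : forall x, ~ K x -> f x = 0.
Hypothesis int_f : 0 < \int[leb R d]_x f x < +oo.

Let phi (y : 'rV[R]_k) := \int[lebesgue_measure]_t f (t *: a + y *m Q)%R.

Hypothesis fD : forall y, phi y * vol shadow <= D%:E * \int[leb R k]_y phi y.

Let phi0 y : 0 <= phi y. Proof. exact: integral_ge0. Qed.

Let phiE (g : 'rV[R]_d -> \bar R) y :
  \int[lebesgue_measure]_t g (t *: a + y *m Q)%R =
  \int[lebesgue_measure]_t g (cons_row (t, y) *m frame a)%R.
Proof. by apply: eq_integral => t _; rewrite cons_row_frame. Qed.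

Let mf_frame g : measurable_fun setT g ->
  measurable_fun setT (fun z : 'rV[R]_k.+1 => g (z *m frame a)%R : \bar R).
Proof. by move=> mg; apply: measurableT_comp => //;
  exact: measurable_mulmx. Qed.

Lemma measurable_integral_axis : measurable_fun setT phi.
Proof.
have -> : phi = fun y =>
  \int[lebesgue_measure]_t f (cons_row (t, y) *m frame a)%R.
  exact: funext (phiE f).
exact: (measurable_integral_line (mf_frame mf) (fun z => f0 _)).
Qed.
Let mphi := measurable_integral_axis.

(** The constant is the Jacobian of the frame; it does not depend on [g]. *)
Lemma integral_axis : exists2 c : R, (0 < c)%R &
  forall g : 'rV[R]_d -> \bar R, measurable_fun setT g ->
    (forall x, 0 <= g x) ->
  \int[leb R d]_x g x =
    c%:E * \int[leb R k]_y \int[lebesgue_measure]_t g (t *: a + y *m Q)%R.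
Proof.
have a0 := axis_neq0 C.
have [c c0 cE] := integral_leb_linear (frameK a0) (frameVK a0).
exists c => // g mg g0;
  rewrite cE// (integral_lebS_row (mf_frame mg) (fun z => g0 _)).
by congr (_ * _); apply: eq_integral => y _; rewrite phiE.
Qed.

Let int_phi : 0 < \int[leb R k]_y phi y < +oo.
Proof.
have [c c0 cE] := integral_axis; move: int_f; rewrite cE//.
have : 0 <= \int[leb R k]_y phi y by exact: integral_ge0.
case: (\int[leb R k]_y phi y) => [I| |]// _.
  by rewrite -EFinM !lte_fin pmulr_rgt0// => /andP[-> _]; rewrite ltry.
by rewrite gt0_muley ?lte_fin.
Qed.

(** If the shadow were null, almost every chord integral would vanish, and then
    the integral of [f] as well. If it were of infinite volume, [fD] at a chord
    with positive integral would make the integral of [f] infinite. *)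
Lemma vol_shadow_gt0_lty : 0 < vol shadow < +oo.
Proof.
have /andP[I0 Ioo] := int_phi.
have [T0 [mT0 ShT0 volT0]] := vol_hull shadow.
have phiT0 y : ~ T0 y -> phi y = 0.
  move=> Ty; apply: integral0_eq => t _; apply: fK => Kt; apply: Ty;
    apply: ShT0.
  by exists t.
apply/andP; split.
  rewrite lt_neqAle eq_sym vol_ge0 andbT; apply: contraTneq I0 => v0.
  rewrite (_ : \int[leb R k]_y phi y = \int[leb R k]_(y in T0) phi y).
    rewrite (_ : \int[leb R k]_(y in T0) phi y = 0) ?ltxx//.
    by apply: null_set_integral => //;
      [exact: measurable_funTS|exact: etrans volT0 v0].
  rewrite [RHS]integral_mkcond; apply: eq_integral => y _; rewrite patchE.
  by case: ifPn => // /negP; rewrite inE => /phiT0.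
have [y0 phiy0] : exists y, 0 < phi y.
  apply/not_existsP => phiN; move: I0; rewrite integral0_eq ?ltxx// => y _.
  by apply/eqP; rewrite eq_le phi0 andbT leNgt; apply/negP.
move: I0 Ioo fD; case: (\int[leb R k]_y phi y) => [I| |]// _ _ fD'.
rewrite ltey; apply: contraTneq (fD' y0) => ->.
by rewrite gt0_muley// -EFinM -ltNge ltry.
Qed.

(** [fD] bounds the chord integrals by a constant, so that the mass of the
    cylinder is at most this constant times the volume of its trace. The set
    [G] is the cylinder over a measurable hull of the trace, because a Lebesgue
    measurable base is in general not Borel. *)
Lemma crv_bound : exists G, [/\ measurable G, cylinder_set C `<=` G &
  \int[leb R d]_(x in G) f x <= D%:E * crv K C * \int[leb R d]_x f x].
Proof.
have a0 := axis_neq0 C; have [c c0 cE] := integral_axis.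
rewrite (cE f)//.
case/andP: int_phi fD; case: (\int[leb R k]_y phi y) => [I| |]// _ _ fD'.
rewrite /crv shadowE traceE.
case/andP: vol_shadow_gt0_lty fD'; case: (vol shadow) => [v| |]// v0 _ fD';
  rewrite lte_fin in v0.
have [G [mG BG GB]] := vol_hull trace.
pose G' := [set x : 'rV[R]_d | G (uncons_row (x *m pinvmx (frame a))).2].
have mG' : measurable G'.
  apply: (measurable_preimage _ mG).
  apply: (measurableT_comp measurable_snd).
  apply: (measurableT_comp (@measurable_uncons_row R k));
    exact: measurable_mulmx.
exists G'; split => //.
  move=> x Cx; case xE : (uncons_row (x *m pinvmx (frame a))) => [t y].
  rewrite /G' /mkset xE; apply: BG; apply: (@trace_cylinder t).
  by rewrite -cons_row_frame -xE uncons_rowK -mulmxA frameVK ?mulmx1.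
have mfG : measurable_fun setT (f \_ G') by apply/(measurable_restrictT _ mG');
  exact: measurable_funTS.
have fG0 x : 0 <= (f \_ G') x by exact: erestrict_ge0.
rewrite integral_mkcond cE//.
have phiB y : phi y <= (D * I / v)%:E.
  by rewrite EFinM lee_pdivlMr// EFinM.
apply: (@le_trans _ _ (c%:E * \int[leb R k]_(y in G) cst (D * I / v)%:E y)).
  rewrite lee_pmul2l ?lte_fin//.
  rewrite (_ : \int[leb R k]_y _ = \int[leb R k]_(y in G) phi y).
    by apply: ge0_le_integral => //; exact: measurable_funTS.
  rewrite [RHS]integral_mkcond; apply: eq_integral => y _; rewrite patchE.
  have fGE t : (f \_ G') (t *: a + y *m Q)%R =
    if y \in G then f (t *: a + y *m Q)%R else 0.
    have GE : G' (cons_row (t, y) *m frame a)%R = G y.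
      by rewrite /G' /mkset -mulmxA frameK// mulmx1 cons_rowK.
    rewrite cons_row_frame in GE *; rewrite patchE (_ : (_ \in G') = (y \in G)).
      by case: ifP.
    by apply/idP/idP => /set_mem H; apply/mem_set; move: H; rewrite GE.
  by under eq_integral do rewrite fGE; case: ifPn => // _; exact: integral0.
rewrite integral_cst//= GB inver gt_eqF//.
rewrite muleA -EFinM [D%:E * _]muleCA -muleA -!EFinM muleC.
by rewrite (_ : c * (D * I / v) = D * v^-1 * (c * I))%R//; ring.
Qed.

End weight.
End cylinder_bound.
Arguments shadow {R d} C K.

Lemma ge0_integral_cover d (T : measurableType d) (R : realType)
    (m : {measure set T -> \bar R}) N (G : 'I_N -> set T) (f : T -> \bar R) :
  (forall i, measurable (G i)) -> measurable_fun setT f ->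
  (forall x, (0 <= f x)%E) -> (forall x, f x = 0%E \/ exists i, G i x) ->
  (\int[m]_x f x <= \sum_(i < N) \int[m]_(x in G i) f x)%E.
Proof.
move=> mG mf f0 fG.
under eq_bigr do rewrite integral_mkcond.
have mfG i : measurable_fun setT (f \_ (G i)).
  by apply/(measurable_restrictT _ (mG i)); exact: measurable_funTS.
have fG0 i x : (0 <= (f \_ (G i)) x)%E by exact: erestrict_ge0.
rewrite -ge0_integral_sum//; apply: ge0_le_integral => //.
  exact: emeasurable_sum.
move=> x _; have [->|[i Gi]] := fG x; first by rewrite sume_ge0.
rewrite (bigD1 i)//= patchE mem_set// leeDl// sume_ge0//.
Qed.

Section covering.
Context (R : realType) (d N : nat) (K : set 'rV[R]_d).
Context (C : 'I_N -> cylinder R d).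
Hypothesis KC : K `<=` \bigcup_(i in [set: 'I_N]) cylinder_set (C i).
Local Open Scope ereal_scope.

Lemma covering_bound (D : R) (f : 'rV[R]_d -> \bar R) : (0 < D)%R ->
  measurable_fun setT f -> (forall x, 0 <= f x) ->
  (forall x, ~ K x -> f x = 0) ->
  0 < \int[leb R d]_x f x < +oo ->
  (forall (i : 'I_N) y,
     \int[lebesgue_measure]_t
       f (t *: axis (C i) + y *m onb (orthogonal (axis (C i))))%R *
       vol (shadow (C i) K) <=
     D%:E * \int[leb R _]_y \int[lebesgue_measure]_t
       f (t *: axis (C i) + y *m onb (orthogonal (axis (C i))))%R) ->
  (D^-1)%:E <= \sum_(i < N) crv K (C i).
Proof.
move=> D0 mf f0 fK foo fD.
have H i := crv_bound mf f0 fK foo (fD i).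
have [G GH] := choice H.
have crv0 i : 0 <= crv K (C i).
  by rewrite /crv mule_ge0// ?inve_ge0 ?vol_ge0.
have : \int[leb R d]_x f x <=
  \sum_(i < N) D%:E * crv K (C i) * \int[leb R d]_x f x.
  apply: le_trans (ge0_integral_cover (leb R d) (G := G) _ mf f0 _) _.
  - by move=> i; have [] := GH i.
  - move=> x; have [/KC[i _ Cx]|/fK] := pselect (K x); last by left.
    by right; exists i; have [_ + _] := GH i; apply.
  - by apply: lee_sum => i _; have [_ _] := GH i.
case/andP: foo; case: (\int[leb R d]_x f x) => [W| |]// W0 _.
rewrite -ge0_sume_distrl; last by move=> i _; rewrite mule_ge0// lee_fin ltW.
rewrite -ge0_sume_distrr// -[leLHS]mul1e lee_pmul2r// => H1.
by rewrite -[leLHS]mule1 lee_pdivrMl.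
Qed.
End covering.

(** * Compact sets *)

Section row_topology.
Context (R : realType) (n : nat).
Implicit Types x y : 'rV[R]_n.

(** The ball of the sup norm, written coordinatewise. *)
Definition cube x (e : R) : set 'rV[R]_n :=
  [set y | forall i, `|x ord0 i - y ord0 i| < e].

Lemma cube_ball x e : 0 < e -> cube x e `<=` ball x e.
Proof.
move=> e0 y xy; split => // i j.
by rewrite (ord1 i); exact: xy.
Qed.

Lemma measurable_cube x e : measurable (cube x e).
Proof.
rewrite (_ : cube x e = \bigcap_(i in [set: 'I_n])
  [set y : 'rV[R]_n | `|x ord0 i - y ord0 i| < e]).
  apply: fin_bigcap_measurable => // i _.
  exact: (measurable_preimage (@measurable_coord R n i)
    (@measurable_ball R (x ord0 i) e)).
by apply/seteqP; split => y /= H i; [move=> _|]; exact: H.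
Qed.

(** An open set is the union of the rational cubes that it contains. *)
Lemma open_measurable_row (U : set 'rV[R]_n) : open U -> measurable U.
Proof.
move=> oU.
pose W (p : 'rV[rat]_n * nat) : set 'rV[R]_n :=
  let B := cube (map_mx ratr p.1) p.2.+1%:R^-1 in
  if `[< B `<=` U >] then B else set0.
have -> : U = \bigcup_p W p.
  apply/seteqP; split => [x Ux|x [p _]]; last first.
    by rewrite /W; case: ifPn => // /asboolP; apply.
  have /nbhs_ballP[e /= e0 eU] := open_nbhs_nbhs (conj oU Ux).
  have [m m1] : exists m : nat, m.+1%:R^-1 < e / 2.
    have e20 : 0 < e / 2 by rewrite divr_gt0.
    by have [m _ H] := near_infty_natSinv_lt (PosNum e20); exists m;
      apply: H => /=.
  have m0 : 0 < m.+1%:R^-1 :> R by rewrite invr_gt0.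
  move: m0 m1; set dl : R := m.+1%:R^-1 => dl0 dle.
  have Hq (i : 'I_n) : exists q : rat, `|ratr q - x ord0 i| < dl.
    have [|q] := @rat_in_itvoo R (x ord0 i - dl) (x ord0 i + dl); first lra.
    by rewrite in_itv /= => /andP[H1 H2]; exists q; rewrite ltr_norml; lra.
  have [q qx] := choice Hq.
  have xB : cube (map_mx ratr (\row_i q i)) dl x.
    by move=> i; rewrite !mxE; exact: qx.
  exists (\row_i q i, m) => //; rewrite /W /= ifT//.
  apply/asboolP => y yB; apply: eU; apply: cube_ball => // i.
  have := xB i; have := yB i; rewrite /= -/dl !mxE !ltr_norml.
  by move=> /andP[? ?] /andP[? ?]; lra.
apply: countable_bigcupT_measurable; first exact: countableP.
move=> p; rewrite /W; case: ifP => _ //; exact: measurable_cube.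
Qed.

Lemma compact_measurable_row (K : set 'rV[R]_n) : compact K -> measurable K.
Proof.
move=> cK; rewrite -[K]setCK; apply: measurableC; apply: open_measurable_row.
by apply: closed_openC; apply: compact_closed => //; exact: norm_hausdorff.
Qed.

Lemma leb_compact_lty (K : set 'rV[R]_n) : compact K -> (leb R n K < +oo)%E.
Proof.
move=> cK; have mK := compact_measurable_row cK.
have [M [Mr MK]] := compact_bounded cK.
pose r := `|M| + 1; have r0 : 0 < r by rewrite ltr_wpDl.
have Kr x : K x -> forall i, `|x ord0 i| <= r.
  move=> Kx i; apply: le_trans (MK r _ x Kx);
    last by rewrite /r (le_lt_trans (ler_norm M)) ?ltrDl.
  by rewrite -[leRHS]/(mx_norm x) mx_normrE;
    exact: (le_bigmax _ (fun ij : 'I_1 * 'I_n => `|x ij.1 ij.2|) (ord0, i)).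
pose s := (2 * r)^-1; have s0 : 0 < s by rewrite invr_gt0 mulr_gt0.
have := @leb_affine R n (const_mx 2^-1) s (@unit_cube R n) s0
  (@measurable_unit_cube R n).
rewrite leb_unit_cube mule1 => E.
apply: (@le_lt_trans _ _ (s ^- n)%:E); last exact: ltry.
rewrite -E; apply: le_measure; rewrite ?inE//.
  apply: (measurable_preimage _ (@measurable_unit_cube R n)).
  by apply: measurable_rowD => //; exact: measurable_rowZ.
move=> x Kx i; have := Kr x Kx i; rewrite !mxE ler_norml => /andP[xr1 xr2].
have rs : r * s = 2^-1 by rewrite /s; field; lra.
have : s * x ord0 i <= s * r by rewrite ler_pM2l.
have : s * (- r) <= s * x ord0 i by rewrite ler_pM2l.
by rewrite mulrN [s * r]mulrC rs; lra.
Qed.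

Lemma leb_interior_gt0 (K : set 'rV[R]_n) : measurable K ->
  interior K !=set0 -> (0 < leb R n K)%E.
Proof.
move=> mK [x /nbhs_ballP[e /= e0 eK]].
pose s := 2 / e; have s0 : 0 < s by rewrite divr_gt0.
have := @leb_affine R n (- (s *: x)) s (@unit_cube R n) s0
  (@measurable_unit_cube R n).
rewrite leb_unit_cube mule1 => E.
apply: (@lt_le_trans _ _ (s ^- n)%:E);
  first by rewrite lte_fin invr_gt0 exprn_gt0.
rewrite -E; apply: le_measure; rewrite ?inE//.
  apply: (measurable_preimage _ (@measurable_unit_cube R n)).
  by apply: measurable_rowD => //; exact: measurable_rowZ.
move=> y yc; apply: eK; apply: cube_ball => // i.
have := yc i; rewrite !mxE -mulrN -mulrDr => /andP[h1 h2].
have es : e / 2 * s = 1 by rewrite /s; field; lra.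
have h3 : - x ord0 i + y ord0 i <= e / 2
  by rewrite -(ler_pM2l s0) [leRHS]mulrC es.
have h4 : 0 <= - x ord0 i + y ord0 i by rewrite -(pmulr_rge0 _ s0).
by rewrite ltr_norml; lra.
Qed.

End row_topology.

(** * Convex bodies *)

Section body_chords.
Context (R : realType) (d : nat) (K : set 'rV[R]_d) (hK : convex_body K).

Lemma measurable_body : measurable K.
Proof. by case: hK => cK _ _; exact: compact_measurable_row. Qed.

Lemma leb_body_gt0_lty : (0 < leb R d K < +oo)%E.
Proof.
by case: hK => cK _ oK; rewrite leb_interior_gt0 ?leb_compact_lty//;
  exact: measurable_body.
Qed.

Lemma body_convex (x y : 'rV[R]_d) (s : R) : 0 <= s <= 1 -> K x -> K y ->
  K ((1 - s) *: x + s *: y).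
Proof.
case: hK => _ cvxK _ /andP[s0 s1] Kx Ky.
have := cvxK y x (Itv01 s0 s1); rewrite !inE => /(_ Ky Kx).
by rewrite addrC.
Qed.

Variable C : cylinder R d.
Let a := axis C.
Let Q := onb (orthogonal a).
Let k := \rank (orthogonal a).

Lemma body_chord_bound (y0 : 'rV[R]_k) :
  (\int[lebesgue_measure]_t (\1_K (t *: a + y0 *m Q)%R)%:E * vol (shadow C K) <=
   d%:R%:E *
   \int[leb R k]_y \int[lebesgue_measure]_t (\1_K (t *: a + y *m Q)%R)%:E)%E.
Proof.
pose L := [set z : 'rV[R]_k.+1 | K (z *m frame a)].
have mL : measurable L.
  by apply: (measurable_preimage _ measurable_body); exact: measurable_mulmx.
have cvxL x y s : 0 <= s <= 1 -> L x -> L y -> L ((1 - s) *: x + s *: y).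
  by move=> s01 Lx Ly; rewrite /L /= mulmxDl -!scalemxAl; exact: body_convex.
have LE (t : R) y : L (cons_row (t, y)) = K (t *: a + y *m Q).
  by rewrite /L /mkset cons_row_frame.
have chordE y : (\int[lebesgue_measure]_t (\1_K (t *: a + y *m Q)%R)%:E =
    lebesgue_measure [set t : R | L (cons_row (t, y))])%E.
  have mLy : measurable [set t : R | L (cons_row (t, y))].
    apply: (measurable_preimage _ mL).
    exact: (measurableT_comp (@measurable_cons_row R k) (measurable_pair2 y)).
  transitivity (\int[@lebesgue_measure R]_t
      (\1_([set t : R | L (cons_row (t, y))] : set (measurableTypeR R))
        t)%:E)%E; last first.
    by rewrite integral_indic// setIT.
  apply: eq_integral => t _; rewrite !indicE.
  rewrite (_ : (_ \in K) = (t \in [set t : R | L (cons_row (t, y))]))//.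
  by apply/idP/idP => /set_mem H; apply/mem_set; move: H; rewrite /= LE.
under [in leRHS]eq_integral do rewrite chordE.
rewrite chordE -leb_chordE//.
have := chord_shadow_le mL cvxL y0.
rewrite (_ : [set y | exists t, L (cons_row (t, y))] = shadow C K).
  by rewrite (_ : k.+1%:R = d%:R :> R)//; congr (_%:R); apply: rank_orthogonal;
    exact: axis_neq0.
by apply/seteqP; split => y [t]; rewrite /= ?LE => Lt; exists t => //;
  rewrite LE.
Qed.
End body_chords.

Lemma convex_body_covering (R : realType) (d N : nat) (K : set 'rV[R]_d)
    (C : 'I_N -> cylinder R d) : convex_body K -> (0 < d)%N ->
  K `<=` \bigcup_(i in [set: 'I_N]) cylinder_set (C i) ->
  ((d%:R^-1 : R)%:E <= \sum_(i < N) crv K (C i))%E.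
Proof.
move=> hK d0 KC; have mK := measurable_body hK.
apply: (covering_bound KC (f := fun x => (\1_K x)%:E)) => //.
- by rewrite ltr0n.
- exact/measurable_EFinP/measurable_indic.
- by move=> x Kx; rewrite indicE memNset.
- by rewrite integral_indic// setIT leb_body_gt0_lty.
- by move=> i y; exact: body_chord_bound.
Qed.

Lemma vol_shadow_body (R : realType) (d : nat) (K : set 'rV[R]_d)
    (C : cylinder R d) : convex_body K -> (0 < vol (shadow C K) < +oo)%E.
Proof.
move=> hK; have mK := measurable_body hK.
apply: (vol_shadow_gt0_lty (D := d%:R) (f := fun x => (\1_K x)%:E)) => //.
- exact/measurable_EFinP/measurable_indic.
- by move=> x Kx; rewrite indicE memNset.
- by rewrite integral_indic// setIT leb_body_gt0_lty.
- by move=> y; exact: body_chord_bound.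
Qed.

(** * The arcsine density *)

Section arcsine_density.
Context (R : realType).

(** Square root and inverse both extend by zero, so that the density vanishes
    for [v >= 1] without a case distinction. *)
Definition arcsine_density (v : R) : R := (Num.sqrt (1 - v))^-1.
Local Notation F := arcsine_density.

Lemma arcsine_density_ge0 v : 0 <= F v.
Proof. by rewrite invr_ge0 sqrtr_ge0. Qed.

Lemma arcsine_density_out v : 1 <= v -> F v = 0.
Proof. by move=> v1; rewrite /F ler0_sqrtr ?invr0// subr_le0. Qed.

Let continuous_F v : v < 1 -> {for v, continuous F}.
Proof.
move=> v1; apply: continuousV.
  by rewrite gt_eqF// sqrtr_gt0 subr_gt0.
apply: continuous_comp; last exact: sqrt_continuous.
by apply: cvgB; [exact: cvg_cst|exact: cvg_id].
Qed.

Lemma measurable_arcsine_density : measurable_fun setT F.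
Proof.
rewrite (_ : setT = `]-oo, 1[ `|` `[1, +oo[); last first.
  by apply/seteqP; split => // v _; have [?|?] := ltP v 1; [left|right];
    rewrite /= in_itv /= ?andbT.
apply/measurable_funU => //; split.
  apply: open_continuous_measurable_fun => //.
  by move=> v; rewrite inE /= in_itv /= => /continuous_F.
apply: (@eq_measurable_fun _ _ _ _ _ (cst (0 : R))); last exact: measurable_cst.
by move=> v; rewrite inE /= in_itv /= andbT => /arcsine_density_out.
Qed.

Lemma arcsine_density_scale (s w : R) : 0 < s ->
  F (1 - s ^+ 2 * (1 - w)) = s^-1 * F w.
Proof.
move=> s0; rewrite /F subKr sqrtrM ?sqr_ge0// sqrtr_sqr ger0_norm ?ltW//.
by rewrite invfM.
Qed.

Definition arcsine_mass : \bar R :=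
  (\int[lebesgue_measure]_t (F (t ^+ 2))%:E)%E.
Local Notation J := arcsine_mass.

Let mFsq : measurable_fun setT (fun t : R => F (t ^+ 2)).
Proof.
by apply: (measurableT_comp measurable_arcsine_density); exact: measurable_funX.
Qed.

Lemma arcsine_mass_gt0 : (0 < J)%E.
Proof.
apply: (@lt_le_trans _ _
    (\int[@lebesgue_measure R]_(t in `]0%R, 1%R[) cst 1%E t)%E).
  rewrite integral_cst//= mul1e lebesgue_measure_itv /= lte_fin ltr01.
  by rewrite oppr0 adde0.
apply: (@le_trans _ _
    (\int[@lebesgue_measure R]_(t in `]0%R, 1%R[) (F (t ^+ 2))%:E)%E).
  apply: ge0_le_integral => //.
  - by apply: measurable_funTS; apply/measurable_EFinP.
  - move=> t; rewrite /= in_itv /= => /andP[t0 t1]; rewrite lee_fin.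
    have t21 : t ^+ 2 < 1 by rewrite expr_lt1// ltW.
    rewrite invf_ge1 ?sqrtr_gt0 ?subr_gt0//.
    by rewrite -[leRHS]sqrtr1 ler_sqrt// gerBl sqr_ge0.
apply: ge0_subset_integral => //; first exact/measurable_EFinP.
by move=> t _; rewrite lee_fin arcsine_density_ge0.
Qed.

(* Integrating up to the singularities at the ends goes through a limit. *)
Let partial (b : R) : 0 < b < 1 ->
  (\int[@lebesgue_measure R]_(t in `[(- b)%R, b]) (F (t ^+ 2))%:E <= pi%:E)%E.
Proof.
move=> /andP[b0 b1].
have in11 t : t \in `[- b, b] -> -1 < t < 1 by rewrite in_itv /=; lra.
rewrite (@continuous_FTC2 _ _ (@asin R)).
- rewrite -EFinB lee_fin.
  have h1 : asin b <= pi / 2 by apply: asin_lepi2; lra.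
  have h2 : - (pi / 2) <= asin (- b) by apply: asin_geNpi2; lra.
  lra.
- lra.
- apply: continuous_subspace_itv => t /in11 /andP[t1 t2].
  apply: (continuous_comp (f := fun t : R => t ^+ 2));
    first exact: exprn_continuous.
  apply: continuous_F; have : 0 < (1 - t) * (1 + t) by rewrite mulr_gt0//; lra.
  by rewrite /= expr2; lra.
- have cont (t : R) : -1 < t < 1 -> {for t, continuous (@asin R)}
  by exact: continuous_asin.
  split.
  + move=> t tb; have t1 : -1 < t < 1 by apply: in11;
    apply: subset_itv_oo_cc tb.
    by have [] := is_derive1_asin t1.
  + by apply: cvg_at_right_filter; apply: cont; lra.
  + by apply: cvg_at_left_filter; apply: cont; lra.
- move=> t tb; have t1 : -1 < t < 1 by apply: in11; apply: subset_itv_oo_cc tb.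
  by rewrite derive1E; have [_] := is_derive1_asin t1.
Qed.

Lemma arcsine_mass_lty : (J < +oo)%E.
Proof.
pose B n : set R := `[- (1 - n.+2%:R^-1), 1 - n.+2%:R^-1]%classic.
have nd : {homo B : n m / (n <= m)%N >-> (n <= m)%O}.
  move=> n m nm; apply/subsetPset; apply: subset_itv; rewrite bnd_simp.
    by rewrite lerN2 lerB// lef_pV2 ?posrE// ler_nat.
  by rewrite lerB// lef_pV2 ?posrE// ler_nat.
have F0 t : (0 <= (F (t ^+ 2))%:E)%E by rewrite lee_fin arcsine_density_ge0.
have mF D : measurable_fun D (fun t : R => (F (t ^+ 2))%:E).
  by apply: measurable_funTS; exact/measurable_EFinP.
have BE : J = (\int[lebesgue_measure]_(t in \bigcup_n B n) (F (t ^+ 2))%:E)%E.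
  rewrite [RHS]integral_mkcond; apply: eq_integral => t _; rewrite patchE.
  case: ifPn => // /negP; rewrite inE => tB.
  rewrite arcsine_density_out//.
  rewrite leNgt; apply/negP => t1; apply: tB.
  have t1' : 0 < 1 - `|t|
    by rewrite subr_gt0 -(@expr_lt1 _ 2)// real_normK// num_real.
  have [m _ H] := near_infty_natSinv_lt (PosNum t1').
  have {}H := H m (leqnn m); rewrite /= in H.
  have m12 : m.+2%:R^-1 <= m.+1%:R^-1 :> R by rewrite lef_pV2 ?posrE// ler_nat.
  exists m => //; rewrite /B /= in_itv /= -ler_norml.
  by move: H m12; set u := _.+1%:R^-1; set v := _.+2%:R^-1; lra.
rewrite BE.
have cv :
    (\int[@lebesgue_measure R]_(t in B i) (F (t ^+ 2))%:E)%E @[i --> \oo] -->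
    (\int[@lebesgue_measure R]_(t in \bigcup_i B i) (F (t ^+ 2))%:E)%E.
  apply: ge0_nondecreasing_set_cvg_integral => //.
  - by move=> i; exact: measurable_itv.
  - by move=> i; exact: mF.
rewrite -(cvg_lim _ cv)//; apply: le_lt_trans (ltry pi).
apply: lime_le; first by apply/cvg_ex; eexists; exact: cv.
apply: nearW => n; apply: partial.
rewrite subr_gt0 invf_lt1// ltr1n /= gtrBl invr_gt0 ltr0n//.
Qed.

(** The substitution t |-> (sqrt (1 - r) t - b) / n maps [-1, 1] onto the chord
    where the parabola is at most 1. It multiplies lengths by sqrt (1 - r) / n
    and divides the density by sqrt (1 - r), so that [r] disappears. *)
Lemma integral_arcsine_parabola (n b r : R) : 0 < n ->
  (\int[lebesgue_measure]_t (F ((b + n * t) ^+ 2 + r)%R)%:E =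
   if (r < 1)%R then n^-1%:E * J else 0)%E.
Proof.
move=> n0; have F0 t : (0 <= (F t)%:E)%E by rewrite lee_fin arcsine_density_ge0.
have mFr : measurable_fun setT (fun u : R => (F (u ^+ 2 + r))%:E).
  apply/measurable_EFinP; apply: (measurableT_comp measurable_arcsine_density).
  by apply: measurable_funD => //; exact: measurable_funX.
rewrite (integral_affine b n0 mFr)//.
case: ltP => r1; last first.
  rewrite integral0_eq ?mule0// => u _; rewrite arcsine_density_out//.
  by have := sqr_ge0 u; lra.
congr (_ * _)%E; pose s := Num.sqrt (1 - r).
have s0 : 0 < s by rewrite sqrtr_gt0 subr_gt0.
have s2 : s ^+ 2 = 1 - r by rewrite sqr_sqrtr// subr_ge0 ltW.
have := integral_affine 0 s0 mFr (fun t => F0 _).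
under eq_integral => t _.
  have -> : (0 + s * t) ^+ 2 + r = 1 - s ^+ 2 * (1 - t ^+ 2).
    by rewrite add0r exprMn s2; ring.
  rewrite arcsine_density_scale// EFinM.
  over.
rewrite ge0_integralZl_EFin//; last 2 first.
- exact/measurable_EFinP.
- by rewrite invr_ge0 ltW.
move=> /(congr1 (fun x => s%:E * x)%E);
  rewrite !muleA -!EFinM mulfV ?gt_eqF// !mul1e.
by move=> <-.
Qed.

End arcsine_density.

(** By Bernoulli's inequality the powers [s ^+ k] come arbitrarily close
    to 1. *)
Lemma le_of_scale_powers (R : realType) (k : nat) (u v : \bar R) : (0 <= v)%E ->
  (forall s : R, 0 < s < 1 -> ((s ^+ k)%:E * v <= u)%E) -> (v <= u)%E.
Proof.
move=> v0 H; apply/lee_mul01Pr => // r /andP[r0 r1].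
have bernoulli (e : R) : 0 <= e <= 1 -> 1 - k%:R * e <= (1 - e) ^+ k.
  move=> /andP[e0 e1]; elim: (k) => [|j IH]; first by rewrite mul0r subr0 expr0.
  have : (1 - e) * (1 - j%:R * e) <= (1 - e) ^+ j.+1
    by rewrite exprS ler_wpM2l// subr_ge0.
  apply: le_trans; rewrite -natr1.
  have : 0 <= j%:R * (e * e) by rewrite !mulr_ge0.
  lra.
pose e := (1 - r) / k.+1%:R.
have k0 : 0 < k.+1%:R :> R by rewrite ltr0n.
have e0 : 0 < e by rewrite divr_gt0// subr_gt0.
have ke : k.+1%:R * e = 1 - r by rewrite /e mulrC divfK// gt_eqF.
have e1 : e < 1.
  have : 1 * e <= k.+1%:R * e by rewrite ler_pM2r// ler1n.
  lra.
have e01 : 0 <= e <= 1 by lra.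
apply: le_trans (H (1 - e) _); last lra.
rewrite lee_wpmul2r// lee_fin; apply: le_trans (bernoulli _ e01).
by move: ke; rewrite -natr1; lra.
Qed.

(** * Ellipsoids *)

Section dot.
Context (R : realType) (d : nat).
Implicit Types u v w : 'rV[R]_d.

Definition dot u v : R := \sum_i u ord0 i * v ord0 i.
Definition sqnorm u : R := \sum_i u ord0 i ^+ 2.

Lemma sqnormDZ (t : R) u v :
  sqnorm (t *: u + v) = sqnorm u * t ^+ 2 + 2 * t * dot u v + sqnorm v.
Proof.
rewrite /sqnorm /dot mulr_suml mulr_sumr -!big_split /=.
by apply: eq_bigr => i _; rewrite !mxE; ring.
Qed.

Lemma sqnormZ (t : R) u : sqnorm (t *: u) = t ^+ 2 * sqnorm u.
Proof. by rewrite /sqnorm mulr_sumr; apply: eq_bigr => i _;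
  rewrite mxE exprMn. Qed.

Lemma sqnorm_gt0 u : u != 0 -> 0 < sqnorm u.
Proof.
move=> u0; rewrite lt_neqAle eq_sym sumr_ge0 ?andbT; last by move=> i _;
  exact: sqr_ge0.
apply: contra u0 => /eqP; rewrite /sqnorm => /psumr_eq0P H.
apply/eqP/rowP => i; rewrite mxE; apply/eqP; rewrite -sqrf_eq0 H// => j _;
  exact: sqr_ge0.
Qed.

Lemma measurable_sqnorm d' (T : measurableType d') (f : T -> 'rV[R]_d) :
  measurable_fun setT f -> measurable_fun setT (fun x => sqnorm (f x)).
Proof.
move=> /measurable_rowP mf; apply: measurable_sum => i; exact: measurable_funX.
Qed.

Lemma measurable_dot d' (T : measurableType d') u (f : T -> 'rV[R]_d) :
  measurable_fun setT f -> measurable_fun setT (fun x => dot u (f x)).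
Proof.
move=> /measurable_rowP mf; apply: measurable_sum => i; exact: measurable_funM.
Qed.

End dot.

Section ellipsoid_chords.
Context (R : realType) (d : nat) (A : 'M[R]_d) (c : 'rV[R]_d).
Hypothesis unitA : A \in unitmx.

Let q (x : 'rV[R]_d) : R := sqnorm ((x - c) *m invmx A).
Let K := [set x | q x <= 1].
Let f (x : 'rV[R]_d) : \bar R := (arcsine_density (q x))%:E.

Lemma ellipsoidE : [set c + x *m A | x in @euclidean_unit_ball R d] = K.
Proof.
apply/seteqP; split => [_ [x xB <-]|x Kx].
  by rewrite /K /q /= addrC addKr mulmxK.
exists ((x - c) *m invmx A); first exact: Kx.
by rewrite mulmxKV// addrC subrK.
Qed.

Lemma measurable_density : measurable_fun setT f.
Proof.
apply/measurable_EFinP;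
  apply: (measurableT_comp (@measurable_arcsine_density R)).
apply: measurable_sqnorm; apply: measurable_mulmx.
by apply: measurable_rowD.
Qed.

Section chords.
Variable C : cylinder R d.
Let a := axis C.
Let Q := onb (orthogonal a).
Let k := \rank (orthogonal a).

(* On the chord over y the quadratic polynomial q is the parabola
   (b y + n t)^2 + r y, by completing the square. *)
Let alpha := a *m invmx A.
Let beta (y : 'rV[R]_k) := (y *m Q - c) *m invmx A.
Let n := Num.sqrt (sqnorm alpha).
Let b y := dot alpha (beta y) / n.
Let r y := sqnorm (beta y) - b y ^+ 2.
Let U := [set y | r y < 1].

Let alpha_gt0 : 0 < sqnorm alpha.
Proof.
apply: sqnorm_gt0; rewrite /alpha; apply: contra (axis_neq0 C) => /eqP a0.
by rewrite -/a -[a](mulmxKV unitA) a0 mul0mx.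
Qed.

Let n0 : 0 < n. Proof. by rewrite sqrtr_gt0. Qed.

Let qE (t : R) y : q (t *: a + y *m Q) = (b y + n * t) ^+ 2 + r y.
Proof.
rewrite /q -addrA mulmxDl -scalemxAl -/(beta y) -/alpha sqnormDZ.
have n2 : sqnorm alpha = n ^+ 2 by rewrite sqr_sqrtr// ltW.
have -> : dot alpha (beta y) = b y * n by rewrite divfK// gt_eqF.
by rewrite /r n2; ring.
Qed.

Let mU : measurable U.
Proof.
have mbeta : measurable_fun setT beta.
  by apply: measurable_mulmx; apply: measurable_rowD => //;
    exact: measurable_mulmx.
have mr : measurable_fun setT r.
  apply: measurable_funB; first exact: measurable_sqnorm.
  by apply: measurable_funX; apply: measurable_funM => //;
    exact: measurable_dot.
have := measurable_preimage mr (@measurable_itv R `]-oo, 1[).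
by rewrite (_ : _ @^-1` _ = U)//; apply/seteqP; split => y; rewrite /= in_itv.
Qed.

(** The value does not depend on [y] as long as the chord meets the interior of
    the ellipsoid. *)
Lemma integral_density_axis y :
  (\int[lebesgue_measure]_t f (t *: a + y *m Q)%R =
   if (r y < 1)%R then (n^-1)%:E * arcsine_mass R else 0)%E.
Proof.
rewrite -(integral_arcsine_parabola (b y) (r y) n0).
by apply: eq_integral => t _; rewrite /f qE.
Qed.

Lemma integral_density_axes :
  (\int[leb R k]_y \int[lebesgue_measure]_t f (t *: a + y *m Q)%R =
   (n^-1)%:E * arcsine_mass R * leb R k U)%E.
Proof.
have J0 := ltW (arcsine_mass_gt0 R);
  have n'0 : 0 <= n^-1 by rewrite invr_ge0 ltW.
transitivity (\int[leb R k]_y ((n^-1)%:E * arcsine_mass R * (\1_U y)%:E))%E.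
  apply: eq_integral => y _; rewrite integral_density_axis indicE.
  case: ifPn => [ry|/negP ry]; first by rewrite mem_set// mule1.
  by rewrite memNset// mule0.
rewrite ge0_integralZl//.
- by rewrite integral_indic// setIT.
- exact/measurable_EFinP/measurable_indic.
- by rewrite mule_ge0.
Qed.

(** [U] is the shadow of the open ellipsoid. Shrinking by [s < 1] towards the
    centre moves the closed ellipsoid into the open one, hence its shadow into
    [U], and [s] may tend to 1. *)
Lemma vol_shadow_ellipsoid : vol (shadow C K) = leb R k U.
Proof.
apply/eqP; rewrite eq_le; apply/andP; split; last first.
  rewrite -volE//; apply: le_vol => y Uy; exists (- b y / n).
  rewrite /K /mkset qE -/a -/Q mulrC divfK ?gt_eqF// subrr expr0n add0r;
    exact: ltW.
apply: (le_of_scale_powers (k := k)); first exact: vol_ge0.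
move=> s /andP[s0 s1].
have [tc [yc cE]] : exists tc yc, c = tc *: a + yc *m Q.
  case E : (uncons_row (c *m pinvmx (frame a))) => [tc yc]; exists tc, yc.
  by rewrite -cons_row_frame -E uncons_rowK -mulmxA frameVK ?mulmx1// axis_neq0.
rewrite -(@lee_pdivlMl R) ?exprn_gt0//.
rewrite -(@leb_affine R k ((1 - s) *: yc) s)//.
rewrite -volE; last first.
  apply: (measurable_preimage _ mU).
  by apply: measurable_rowD => //; exact: measurable_rowZ.
apply: le_vol => y [t Kt]; rewrite /U /mkset.
set y' := _ + _; set t' := (1 - s) * tc + s * t.
have qs : q (t' *: a + y' *m Q) = s ^+ 2 * q (t *: a + y *m Q).
  rewrite /q -sqnormZ scalemxAl; congr sqnorm; congr (_ *m _).
  rewrite /y' /t' mulmxDl -!scalemxAl [c]cE.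
  move: (y *m Q) (yc *m Q) => Y Yc; apply/rowP => i; rewrite !mxE; ring.
have : q (t' *: a + y' *m Q) < 1.
  rewrite qs; have s21 : s ^+ 2 < 1 by rewrite expr_lt1// ltW.
  apply: le_lt_trans s21; rewrite -[leRHS]mulr1 ler_wpM2l ?sqr_ge0//.
by rewrite qE; have := sqr_ge0 (b y' + n * t'); lra.
Qed.

Lemma ellipsoid_chord_bound y0 :
  (\int[lebesgue_measure]_t f (t *: a + y0 *m Q)%R * vol (shadow C K) <=
   1%:E * \int[leb R k]_y \int[lebesgue_measure]_t f (t *: a + y *m Q)%R)%E.
Proof.
rewrite integral_density_axes integral_density_axis vol_shadow_ellipsoid mul1e.
case: ifP => // _; rewrite mul0e !mule_ge0//; last exact/ltW/arcsine_mass_gt0.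
by rewrite lee_fin invr_ge0 ltW.
Qed.

Lemma integral_density_gt0_lty : convex_body K ->
  (0 < \int[leb R d]_x f x < +oo)%E.
Proof.
move=> hK.
have f0 x : (0 <= f x)%E by rewrite lee_fin arcsine_density_ge0.
have [e e0 eE] := integral_axis C.
rewrite eE//; last exact: measurable_density.
rewrite integral_density_axes -vol_shadow_ellipsoid.
have := vol_shadow_body C hK; have := arcsine_mass_gt0 R;
  have := arcsine_mass_lty R.
case: (arcsine_mass R) => [J| |]// _ J0; case: (vol _) => [v| |]// /andP[v0 //].
move=> _; rewrite !lte_fin in J0 v0 *.
by rewrite -!EFinM ltry andbT !mulr_gt0// invr_gt0.
Qed.

End chords.
End ellipsoid_chords.

Lemma ellipsoid_covering (R : realType) (d N : nat) (K : set 'rV[R]_d)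
    (C : 'I_N -> cylinder R d) : convex_body K -> ellipsoid K ->
  K `<=` \bigcup_(i in [set: 'I_N]) cylinder_set (C i) ->
  (1 <= \sum_(i < N) crv K (C i))%E.
Proof.
move=> hK [A [c [unitA KE]]] KC; rewrite ellipsoidE// in KE.
have [i0 _] : exists i : 'I_N, True.
  case: hK => _ _ [x /interior_subset /KC[i _ _]]; by exists i.
pose f (x : 'rV[R]_d) : \bar R := (arcsine_density (sqnorm
  ((x - c) *m invmx A)))%:E.
rewrite -[1%E]/(1%:E) -[X in X%:E]invr1.
rewrite KE in hK KC *.
apply: (covering_bound KC (f := f)) => //.
- exact: measurable_density.
- by move=> x; rewrite lee_fin arcsine_density_ge0.
- move=> x /negP; rewrite -ltNge => q1; rewrite /f arcsine_density_out//;
  exact: ltW.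
- exact: (integral_density_gt0_lty unitA (C i0) hK).
- by move=> i y; exact: ellipsoid_chord_bound.
Qed.

Theorem theorem3p1 (R : realType) (d N : nat) (K : set 'rV[R]_d)
    (C : 'I_N -> cylinder R d) (hK : convex_body K)
    (hC : K `<=` \bigcup_(i in [set: 'I_N]) cylinder_set (C i)) :
  ((d%:R^-1 : R)%:E <= \sum_(i < N) crv K (C i))%E /\
  (ellipsoid K -> (1 <= \sum_(i < N) crv K (C i))%E).
Proof.
split=> [|eK]; last exact: ellipsoid_covering.
apply: convex_body_covering => //.
(* The body is nonempty, so some cylinder has a nonzero axis in R^d. *)
have [_ _ [x /interior_subset/hC[i _ _]]] := hK.
by rewrite -(rank_orthogonal (axis_neq0 (C i))).
Qed.
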